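(* A finite simple graph $\Gamma$ is isomorphic to the prime graph of a pseudo $U_3(3)$-solvable group if and only if its complement $\overline{\Gamma}$ is $3$-colorable and triangle-free.
   Context: All groups are finite and all graphs are simple. For a finite group $G$, the prime graph $\Gamma(G)$ has as vertices the prime divisors of $|G|$; two distinct vertices $p,q$ are adjacent if and only if $G$ contains an element of order $pq$. $U_3(3)$ is the projective special unitary group of degree $3$ over the field with $3^2$ elements (a simple group of order $2^5\cdot 3^3\cdot 7$). A group is pseudo $U_3(3)$-solvable if each of its composition factors is abelian or isomorphic to $U_3(3)$ (in particular solvable groups are allowed). *)

(* Defs.v *)
From HB Require Import structures.
From mathcomp Require Import all_boot all_order all_algebra.
From mathcomp Require Import all_fingroup all_solvable all_field.

Set Implicit Arguments.
Unset Strict Implicit.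
Unset Printing Implicit Defensive.

Import GRing.Theory.
Local Open Scope group_scope.

Record sgraph := SGraph {
  vertex :> finType;
  adj : rel vertex;
  adj_sym : symmetric adj;
  adj_irrefl : irreflexive adj }.

Definition sgraph_iso (X Y : sgraph) : Prop :=
  exists2 f : X -> Y, bijective f & forall x y : X, adj (f x) (f y) = adj x y.

Definition compl_adj (X : sgraph) : rel X :=
  [rel x y | (x != y) && ~~ adj x y].

Lemma compl_adj_sym (X : sgraph) : symmetric (@compl_adj X).
Proof. by move=> x y; rewrite /compl_adj /= eq_sym adj_sym. Qed.

Lemma compl_adj_irrefl (X : sgraph) : irreflexive (@compl_adj X).
Proof. by move=> x; rewrite /compl_adj /= eqxx. Qed.

Definition complement (X : sgraph) : sgraph :=
  SGraph (@compl_adj_sym X) (@compl_adj_irrefl X).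

Definition colorable (k : nat) (X : sgraph) : Prop :=
  exists c : X -> 'I_k, forall x y : X, adj x y -> c x != c y.

Definition triangle_free (X : sgraph) : Prop :=
  ~ exists x y z : X, [&& adj x y, adj y z & adj x z].

Definition prime_adj (gT : finGroupType) (G : {group gT}) :
    rel (seq_sub (primes #|G|)) :=
  [rel p q | (p != q) && [exists x in G, #[x] == (ssval p * ssval q)%N]].

Lemma prime_adj_sym (gT : finGroupType) (G : {group gT}) :
  symmetric (@prime_adj gT G).
Proof.
by move=> p q; rewrite /prime_adj /= eq_sym mulnC.
Qed.

Lemma prime_adj_irrefl (gT : finGroupType) (G : {group gT}) :
  irreflexive (@prime_adj gT G).
Proof. by move=> p; rewrite /prime_adj /= eqxx. Qed.

Definition prime_graph (gT : finGroupType) (G : {group gT}) : sgraph :=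
  SGraph (@prime_adj_sym gT G) (@prime_adj_irrefl gT G).

Lemma F9_spec : {F : finFieldType | 3 \in [pchar F]%R & #|F| = (3 ^ 2)%N}.
Proof. exact: pPrimePowerField. Qed.

Definition F9 : finFieldType := s2val F9_spec.

Definition F9_pchar : 3 \in [pchar F9]%R := s2valP F9_spec.

Lemma card_F9 : #|F9| = 9.
Proof. exact: s2valP' F9_spec. Qed.

(* The involution a |-> a ^+ 3 of F9. *)
Definition bar9 : {rmorphism F9 -> F9} := pFrobenius_aut F9_pchar.

(* The isometries of determinant 1 of the Hermitian form \sum_i x_i * bar9 y_i
   on F9^3; up to equivalence this is the only nondegenerate Hermitian form. *)
Definition SU33_set : {set {'GL_3[F9]}} :=
  [set g | (GLval g *m (map_mx bar9 (GLval g))^T == 1%:M)%R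
           && (\det (GLval g) == 1)%R].

Lemma SU33_group_set : group_set SU33_set.
Proof.
apply/group_setP; split=> [|g h].
  by rewrite inE GL_1E map_mx1 trmx1 mulmx1 det1 !eqxx.
rewrite !inE => /andP[/eqP ug /eqP dg] /andP[/eqP uh /eqP dh].
rewrite GL_MxE map_mxM trmx_mul mulmxA -(mulmxA (GLval g)) uh mulmx1 ug eqxx.
by rewrite det_mulmx dg dh mulr1 eqxx.
Qed.

Canonical SU33 : {group {'GL_3[F9]}} := Group SU33_group_set.

Definition U33 : {group coset_of 'Z(SU33)} := (SU33 / 'Z(SU33))%G.

Definition pseudo_U33_solvable (gT : finGroupType) (G : {group gT}) : Prop :=
  forall s : seq {group gT}, comps G s ->
  forall X : section gT, X \in mkfactors G s -> abelian X \/ X \isog U33.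

(* Main.v *)
(* From groups to graphs. In a solvable group, orient a pair of non-adjacent
   primes p, q from p to q when p divides the order of the abelianization of a
   Hall {p, q}-subgroup. There is no directed walk of length 3, so the number of
   steps (0, 1 or 2) that can still be made from a prime is a proper coloring of
   the complement; the complement is triangle-free by Lucido's lemma. If G has a
   composition factor U_3(3), then 2 and 3 are adjacent to each other and to every
   other prime divisor of |G| except possibly 7, since the Sylow 2- and 3-subgroups
   of U_3(3) cannot act freely on a p-group, and the Frattini argument gives a
   solvable subgroup whose order is divisible by the primes other than 2 and 3; its
   coloring extends to 2 and 3.

   From graphs to groups. Label the vertices by primes such that p_u divides
   p_v - 1 whenever the color of u is below that of v. The non-edges between the
   colors 0 and 1 are realised by a metacyclic group <m> : <s>. Every vertex w of
   color 2 is then added by an induced module in characteristic p_w, on which the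
   elements of order p_u have no fixed vector exactly for the neighbours u of w
   in the complement; triangle-freeness provides the linear character that is
   induced. *)

Require Import Defs.
From mathcomp Require Import all_boot all_order all_algebra all_fingroup all_solvable all_field ring.

Set Implicit Arguments.
Unset Strict Implicit.
Unset Printing Implicit Defensive.

Import GRing.Theory FiniteModule.
Local Open Scope group_scope.

(** * The prime graph of a solvable group *)

(** The bound on walks is a statement about one Sylow subgroup. For a walk p, q, r, s, a Sylow
    r-subgroup acts on the s-core of the quotient by the s'-core; as r and s are not adjacent, the
    action is free and the rank is 1. If the Sylow r-subgroup is cyclic, the quotient by the r'-core
    has a cyclic Fitting subgroup with abelian quotient, in which p and q would have to be adjacent.
    The prime r = 2 needs its own argument because of quaternion groups. All free actions are
    handled by one averaging argument over a partition of a group, in place of Frobenius theory. In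
    U_3(3) the decisive number is 504 = 2^3 * 3^2 * 7, the count of the elements of order 6: an
    automorphism of prime order other than 2, 3 and 7 must fix one of them. The count is evaluated
    on explicit matrices. In the construction, the neighbors of w in the complement have colors 0
    and 1, and no two of them are neighbors because there is no triangle. The corresponding parts of
    <m> and <s> therefore commute and form a cyclic section, which carries a faithful linear
    character. *)

Definition has_order (gT : finGroupType) (G : {set gT}) (n : nat) :=
  [exists x in G, #[x] == n].

Lemma has_orderP (gT : finGroupType) (G : {set gT}) n :
  reflect (exists2 x, x \in G & #[x] = n) (has_order G n).
Proof.
apply: (iffP existsP) => [[x /andP[Gx /eqP ox]] | [x Gx ox]]; first by exists x.
by exists x; rewrite Gx ox /=.
Qed.

Lemma has_orderS (gT : finGroupType) (H G : {set gT}) n :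
  H \subset G -> has_order H n -> has_order G n.
Proof.
by move=> sHG /has_orderP[x Hx ox]; apply/has_orderP; exists x; rewrite ?(subsetP sHG).
Qed.

Lemma has_order_morphim (aT rT : finGroupType) (D : {group aT})
    (f : {morphism D >-> rT}) (G : {group aT}) n :
  has_order (f @* G) n -> has_order G n.
Proof.
case/has_orderP=> _ /morphimP[x Dx Gx ->] on.
have dvn : n %| #[x] by rewrite -on morph_order.
apply/has_orderP; exists (x ^+ (#[x] %/ n)); first by rewrite groupX.
by rewrite orderXdiv ?dvdn_div // divnA // mulKn.
Qed.

Lemma has_order_quotient (gT : finGroupType) (G N : {group gT}) n :
  has_order (G / N) n -> has_order G n.
Proof. exact: has_order_morphim. Qed.

Lemma has_order_mul (gT : finGroupType) (G : {group gT}) x y :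
  x \in G -> y \in G -> commute x y -> coprime #[x] #[y] ->
  has_order G (#[x] * #[y]).
Proof.
move=> Gx Gy cxy co_xy; apply/has_orderP; exists (x * y); first exact: groupM.
exact: orderM.
Qed.

Lemma prime_coprimeE p q : prime p -> prime q -> coprime p q = (p != q).
Proof. by move=> p_pr q_pr; rewrite prime_coprime // dvdn_prime2. Qed.

Lemma has_order_abelian (gT : finGroupType) (G : {group gT}) p q :
  abelian G -> prime p -> prime q -> p != q -> p %| #|G| -> q %| #|G| ->
  has_order G (p * q).
Proof.
move=> abG p_pr q_pr npq /(Cauchy p_pr)[x Gx ox] /(Cauchy q_pr)[y Gy oy].
rewrite -{1}ox -oy; apply: has_order_mul => //; first exact: (centsP abG).
by rewrite ox oy prime_coprimeE.
Qed.

(* If the sets H^# for a family of subgroups H partition E^#, then summing the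
   action of E on V over the blocks shows that not every H acts without fixed
   points. *)
Lemma partition_fixed_point (gT : finGroupType) (E V : {group gT})
    (P : {set {set gT}}) :
    E \subset 'N(V) -> abelian V -> V :!=: 1 -> partition P E^# -> P != set0 ->
    (forall B, B \in P -> exists H : {group gT}, B = H^#) ->
    coprime #|P|.-1 #|V| ->
  exists2 x, x \in E^# & 'C_V[x] != 1.
Proof.
move=> nVE abV ntV partP ntP grP coP; apply/exists_inP; apply: contraT.
rewrite negb_exists => /forallP regE.
have{}regE x : x \in E^# -> 'C_V[x] = 1.
  by move=> Ex; have:= regE x; rewrite Ex negbK => /eqP.
pose fmT := fmod_of abV.
pose S (A : {set gT}) (u : fmT) : fmT := (\sum_(x in A) u ^@ x)%R.
(* The sum over a nontrivial subgroup is fixed by that subgroup, hence vanishes. *)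
have S0 (H : {group gT}) u : H \subset E -> H :!=: 1 -> S H u = 0%R.
  move=> sHE ntH; have [x Hx ntx] := trivgPn _ ntH.
  have Ex: x \in E^# by rewrite !inE ntx (subsetP sHE).
  have nVH: H \subset 'N(V) := subset_trans sHE nVE.
  have fixS: (S H u ^@ x = S H u)%R.
    rewrite /S actr_sum [RHS](reindex_inj (mulIg x)) /=.
    rewrite [RHS](eq_bigl [in H]) => [|y]; last by rewrite groupMr.
    by apply: eq_bigr => y Hy; rewrite actrM ?(subsetP nVH).
  apply: val_inj; apply/set1P; rewrite -[[set _]](regE x Ex) inE fmodP.
  apply/cent1P/commgP/conjg_fixP.
  by rewrite -fmvalJ ?(subsetP nVH) ?fixS.
have [v Vv ntv] := trivgPn _ ntV.
pose u : fmT := fmod abV v.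
have [covP trivP P0] := and3P partP.
have ntE: E :!=: 1.
  by apply: contraNneq ntP => E1; move: partP; rewrite E1 setDv partition_set0.
have SP B : B \in P -> S B u = (- u)%R.
  move=> PB; have [H defB] := grP B PB.
  have sHE: H \subset E.
    rewrite -(setD1K (group1 H)) -defB subUset sub1G (subset_trans _ (subD1set E 1)) //.
    by rewrite -(eqP covP) (bigcup_max B).
  have ntH: H :!=: 1.
    by apply: contraNneq P0 => H1; rewrite defB H1 setDv in PB.
  have:= S0 H u sHE ntH; rewrite /S (big_setD1 1) //= actr1 -defB => /eqP.
  by rewrite addrC addr_eq0 => /eqP.
(* The sum over [E^#] is -u as a whole and #|P| times -u block by block, so #|P|.-1 kills u. *)
have := S0 E u (subxx E) ntE; rewrite /S (big_setD1 1) //= actr1.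
rewrite -{1}(eqP covP) big_trivIset //= (eq_bigr (fun=> - u)%R); last first.
  exact: SP.
rewrite sumr_const mulNrn; have: (0 < #|P|) by rewrite card_gt0.
case: #|P| coP => // m com _; rewrite mulrS opprD addNKr => /eqP.
rewrite oppr_eq0 => /eqP um0; case/eqP: ntv.
have: v ^+ m = 1 by rewrite -[v](fmodK abV) // -fmvalZ um0.
move/eqP; rewrite -order_dvdn => dv_m; apply/eqP; rewrite -order_eq1 -dvdn1.
by rewrite -(eqP com) dvdn_gcd dv_m order_dvdG.
Qed.

Lemma prime_order_partition (gT : finGroupType) (E : {group gT}) :
    (forall x, x \in E^# -> prime #[x]) ->
  partition [set <[x]>^# | x in E^#] E^#.
Proof.
move=> primeE; have eqE x z : x \in E^# -> z \in <[x]>^# -> <[z]> = <[x]>.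
  move=> /primeE p_x /setD1P[ntz xz]; apply/eqP; rewrite eqEcard cycle_subG xz /=.
  have := order_dvdG xz; rewrite -orderE dvdn_prime2 ?[#[x] in X in X <= _]/= //.
    by rewrite -!orderE => /eqP->.
  have [_ xE] := primeP p_x; have /orP[] := xE _ (order_dvdG xz).
    by rewrite order_eq1 (negPf ntz).
  by move/eqP->.
have memE x : x \in E^# -> x \in <[x]>^#.
  by case/setD1P=> ntx _; rewrite !inE ntx cycle_id.
apply/and3P; split.
- apply/eqP/setP=> z; apply/bigcupP/idP=> [[_ /imsetP[x Ex ->] xz] | Ez].
    case/setD1P: xz => ntz xz; rewrite !inE ntz /=.
    by case/setD1P: Ex => _ Ex; apply: subsetP xz; rewrite cycle_subG.
  by exists <[z]>^#; [apply/imsetP; exists z | apply: memE].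
- apply/trivIsetP=> _ _ /imsetP[x Ex ->] /imsetP[y Ey ->] neq_xy.
  apply/pred0P=> z /=; apply: contraNF neq_xy => /andP[xz yz].
  by rewrite -(eqE x z) // -(eqE y z).
by apply/imsetP=> [[x Ex x0]]; have:= memE x Ex; rewrite -x0 inE.
Qed.

Lemma has_order_mul_cent (gT : finGroupType) (G V : {group gT}) x (t : nat) :
    V \subset G -> t.-group V -> x \in G -> prime #[x] -> #[x] != t ->
  'C_V[x] != 1 -> has_order G (#[x] * t).
Proof.
move=> sVG tV Gx x_pr nxt ntC.
have tC: t.-group 'C_V[x] := pgroupS (subsetIl _ _) tV.
have [t_pr t_C _] := pgroup_pdiv tC ntC.
have [y /setIP[Vy /cent1P cxy] oy] := Cauchy t_pr t_C.
rewrite -oy; apply: has_order_mul; rewrite ?(subsetP sVG y) //.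
by rewrite prime_coprimeE ?oy.
Qed.

(** An elementary abelian group of order r ^ 2 is partitioned by its r + 1 subgroups of order r, and
    r is prime to #|V|; so one of its nontrivial elements has a fixed point. *)
Lemma p_rank1_of_free (gT : finGroupType) (G R V : {group gT}) r s :
    prime r -> r != s -> R \subset G -> V \subset G -> R \subset 'N(V) ->
    s.-group V -> V :!=: 1 -> r.-group R -> ~~ has_order G (r * s) ->
  'r_r(R) <= 1.
Proof.
move=> r_pr nrs sRG sVG nVR sV ntV rR; apply: contraR; rewrite -ltnNge => r2.
have [s_pr s_V _] := pgroup_pdiv sV ntV.
(* The center of [V] is characteristic and nontrivial, so it inherits all the hypotheses. *)
wlog abV: V sVG nVR sV ntV {s_V} / abelian V.
  move=> IH; apply: (IH ('Z(V))%G).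
  - exact: subset_trans (center_sub V) sVG.
  - exact: subset_trans nVR (gFnorms _ _).
  - exact: pgroupS (center_sub V) sV.
  - by rewrite /= center_nil_eq1 ?(pgroup_nil sV).
  - exact: center_abelian.
have /p_rank_geP[E /pnElemP[sER abE logE]] := r2.
have rE: r.-group E := pgroupS sER rR.
have oE: #|E| = (r ^ 2)%N by rewrite (card_pgroup rE) logE.
have ordE x : x \in E^# -> #[x] = r.
  by case/setD1P=> ntx Ex; apply: (abelem_order_p abE).
have partE: partition [set <[x]>^# | x in E^#] E^#.
  by apply: prime_order_partition => x /ordE->.
set P := [set _ | _ in _] in partE.
have cardP: #|P| = r.+1.
  have uniP: {in P, forall A : {set gT}, #|A| = r.-1}.
    move=> _ /imsetP[x Ex ->].
    by have := cardsD1 1 <[x]>; rewrite group1 -orderE ordE // => ->.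
  have := card_uniform_partition uniP partE.
  have ->: #|E^#| = (r.+1 * r.-1)%N.
    have := cardsD1 1 E; rewrite group1 oE add1n => r2E.
    have: (r ^ 2)%N.-1 = #|E^#| by rewrite r2E.
    by move<-; rewrite -subn1 -[1%N in LHS](exp1n 2) subn_sqr addn1 subn1 mulnC.
  have r1_gt0: 0 < r.-1 by rewrite -subn1 subn_gt0 prime_gt1.
  by move/eqP; rewrite eqn_pmul2r // => /eqP.
have [||B /imsetP[x Ex ->]||x Ex ntCx] := partition_fixed_point _ abV ntV partE.
- exact: subset_trans sER nVR.
- by rewrite -card_gt0 cardP.
- by exists <[x]>%G.
- rewrite cardP /= prime_coprime //; apply: contra nrs => rV.
  by have := pgroupP sV r r_pr rV.
have [ntx Rx] : x != 1 /\ x \in R.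
  by case/setD1P: Ex => ntx /(subsetP sER).
by rewrite -(ordE x Ex); apply: has_order_mul_cent ntCx; rewrite ?ordE ?(subsetP sRG).
Qed.

(** Counts the nontrivial elements of a group of order u v that are covered by one block of u - 1
    elements and n blocks of v - 1 elements. *)
Lemma count_blocks u v n :
  1 < v -> 1 < u -> ((u * v).-1 = u.-1 + n * v.-1)%N -> n = u.
Proof.
case: v => // v; case: u => // u; rewrite !ltnS => v_gt0 _.
rewrite mulSn mulnS addSn !succnK addnCA => /addnI; rewrite -mulSn => /eqP.
by rewrite eqn_pmul2r // => /eqP->.
Qed.

(* The case where the solvable group K has a normal subgroup of order u is the
   Frobenius group of order u v, partitioned by A and the u conjugates of <[y]>. *)
Lemma has_order_of_action (gT : finGroupType) (G K V : {group gT}) (u v t : nat) :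
    solvable K -> prime u -> prime v -> u != v -> u != t -> v != t ->
    K \subset G -> V \subset G -> K \subset 'N(V) -> t.-group V -> V :!=: 1 ->
    u %| #|K| -> v %| #|K| -> (pred2 u v : nat_pred).-group K ->
  [|| has_order G (u * v), has_order G (u * t) | has_order G (v * t)].
Proof.
move=> solK u_pr v_pr nuv nut nvt sKG sVG nVK tV ntV u_K v_K uvK.
wlog abV: V sVG nVK tV ntV / abelian V.
  move=> IH; apply: (IH ('Z(V))%G).
  - exact: subset_trans (center_sub V) sVG.
  - exact: subset_trans nVK (gFnorms _ _).
  - exact: pgroupS (center_sub V) tV.
  - by rewrite /= center_nil_eq1 ?(pgroup_nil tV).
  - exact: center_abelian.
have ntK: K :!=: 1 by apply: contraTneq u_K => ->; rewrite cards1 gtnNdvd ?prime_gt1.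
have [A [sAK nsAK ntA /is_abelemP[a a_pr abA]]] := solvable_norm_abelem solK (normal_refl K) ntK.
have a_A: a %| #|A| by have [] := pgroup_pdiv (abelem_pgroup abA) ntA.
have: a \in pred2 u v by apply: (pgroupP uvK) => //; apply: dvdn_trans a_A (cardSg sAK).
(* The statement is symmetric in u and v, so the prime of the minimal normal subgroup [A] may be
   called u. *)
wlog def_a: u v u_pr v_pr nuv nut nvt u_K v_K uvK / a = u.
  move=> IH; rewrite inE => /orP[] /eqP def_a; first by apply: IH; rewrite ?inE ?def_a ?eqxx.
  rewrite [has_order G (u * t) || _]orbC [(u * v)%N]mulnC; apply: IH; rewrite ?inE ?def_a ?eqxx //.
    by rewrite eq_sym.
  by apply: etrans uvK; apply: eq_pgroup => x; rewrite !inE orbC.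
move=> _; subst a; have uA := abelem_pgroup abA.
apply: contraT; rewrite !negb_or => /and3P[no_uv no_ut no_vt].
have oA: #|A| = u.
  apply/eqP; rewrite (card_pgroup uA) -[X in _ == X]expn1 eqn_exp2l ?prime_gt1 //.
  have := p_rank1_of_free u_pr nut (subset_trans sAK sKG) sVG _ tV ntV uA no_ut.
  rewrite (p_rank_abelem abA) eqn_leq => ->; last exact: subset_trans sAK _.
  by rewrite lognE u_pr cardG_gt0 a_A.
have [y Ky oy] := Cauchy v_pr v_K.
have nAy: <[y]> \subset 'N(A) by rewrite cycle_subG (subsetP (normal_norm nsAK)).
pose E := (A <*> <[y]>)%G.
have sEK: E \subset K by rewrite join_subG sAK cycle_subG.
have coAy: coprime #|A| #|<[y]>| by rewrite -orderE oA oy prime_coprimeE.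
have oE: #|E| = (u * v)%N.
  by rewrite /= norm_joinEr // coprime_cardMg // -orderE oA oy.
have ordE x : x \in E^# -> #[x] = u \/ #[x] = v.
  case/setD1P=> ntx Ex; have := order_dvdG Ex; rewrite oE => dv_x.
  have [/dvdnP[k def_x] | n_xu] := boolP (u %| #[x]).
    move: dv_x; rewrite def_x mulnC dvdn_pmul2l ?prime_gt0 //.
    have [_ dvP] := primeP v_pr; case/dvP/orP=> /eqP def_k; first by rewrite def_k muln1; left.
    case/has_orderP: no_uv; exists x; last by rewrite def_x def_k mulnC.
    exact: subsetP (subset_trans sEK sKG) x Ex.
  move: dv_x; rewrite Gauss_dvdr; last by rewrite coprime_sym prime_coprime.
  have [_ dvP] := primeP v_pr; case/dvP/orP=> /eqP def_x; last by right.
  by case/eqP: ntx; apply/eqP; rewrite -order_eq1 def_x.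
have partE: partition [set <[x]>^# | x in E^#] E^#.
  by apply: prime_order_partition => x /ordE[]->.
set P := [set _ | _ in _] in partE.
have sAE: A \subset E by apply: joing_subl.
have hallA: u.-Hall(E) A.
  rewrite /pHall sAE uA -divgS // oE oA mulKn ?prime_gt0 //.
  by rewrite pnatE // !inE eq_sym.
have nsAE: A <| E by rewrite normalYl.
have defA x : x \in E^# -> #[x] = u -> <[x]> = A.
  case/setD1P=> _ Ex ox; apply/eqP; rewrite eqEcard -orderE ox oA leqnn andbT.
  rewrite (sub_normal_Hall hallA) ?cycle_subG // /pgroup -orderE ox.
  exact: pnat_id.
have PA: A^# \in P.
  have [x Ax ntx] := trivgPn _ ntA.
  have Ex: x \in E^# by rewrite !inE ntx (subsetP sAE).
  apply/imsetP; exists x => //; rewrite (defA x) //.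
  apply/eqP; rewrite -(dvdn_prime2 _ u_pr); last by case: (ordE x Ex) => ->.
  by rewrite -oA order_dvdG.
(* All blocks other than [A^#] have v - 1 elements. The resulting number u is prime to #|V|, as the
   averaging argument requires. *)
have cardP: #|P|.-1 = u.
  have := card_partition partE; rewrite (bigD1 A^#) //= => defE1.
  have cB (B : {set gT}) : (B \in P) && (B != A^#) -> #|B| = v.-1.
    case/andP=> /imsetP[x Ex ->] nBA.
    have := cardsD1 1 <[x]>; rewrite group1 -orderE; case: (ordE x Ex) => [ox | -> ->//].
    by rewrite (defA x) ?eqxx in nBA.
  move: defE1; rewrite (eq_bigr _ cB) sum_nat_const.
  have ->: #|[pred B | B \in P & B != A^#]| = #|P|.-1.
    by rewrite (cardsD1 A^# P) PA /=; apply: eq_card => B; rewrite !inE andbC.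
  have c1 (H : {group gT}) : #|H^#| = #|H|.-1.
    by have := cardsD1 1 H; rewrite group1 => ->.
  rewrite !c1 oE oA; have := prime_gt1 u_pr; have := prime_gt1 v_pr.
  by move: #|P|.-1 => n; apply: count_blocks.
have [||B /imsetP[x Ex ->]||x Ex ntCx] := partition_fixed_point _ abV ntV partE.
- exact: subset_trans sEK nVK.
- by apply/set0Pn; exists A^#.
- by exists <[x]>%G.
- rewrite cardP prime_coprime //; apply: contra nut => uV.
  by have := pgroupP tV u u_pr uV.
have Gx: x \in G by apply: subsetP (subset_trans sEK sKG) _ _; case/setD1P: Ex.
case: (ordE x Ex) => ox; [case/negP: no_ut | case/negP: no_vt]; rewrite -ox;
  by apply: has_order_mul_cent ntCx; rewrite ?ox.
Qed.

(** The Fitting subgroup of [C] lies in 'F(G), hence is central in [C]. A minimal normal subgroup of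
    C / 'Z(C) would have a preimage of class at most 2, which is nilpotent and normal and so falls
    back into 'Z(C). *)
Lemma cent_Fitting_sub (gT : finGroupType) (G : {group gT}) :
  solvable G -> 'C_G('F(G)) \subset 'F(G).
Proof.
move=> solG; set C := 'C_G('F(G)).
have nsCG: C <| G by rewrite /C /normal subsetIl normsI ?normG ?norms_cent ?gFnorm.
have sFF: 'F(C) \subset 'F(G).
  by rewrite Fitting_max ?Fitting_nil // (char_normal_trans (Fitting_char _)).
have sFC: 'F(C) \subset 'Z(C).
  rewrite subsetI Fitting_sub centsC (subset_trans _ (centS sFF)) //.
  exact: subsetIr.
have [CZ | ntCZ] := eqVneq (C / 'Z(C)) 1.
  have sCZ: C \subset 'Z(C) by rewrite -quotient_sub1 ?CZ ?gFnorm.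
  by rewrite Fitting_max // abelian_nil //; apply: abelianS sCZ (center_abelian _).
have solC: solvable C := solvableS (subsetIl _ _) solG.
have [Mb [sMC nsMC ntM /is_abelemP[p _ /abelem_abelian abM]]] :=
  solvable_norm_abelem (quotient_sol _ solC) (normal_refl (C / 'Z(C))) ntCZ.
have [M defM sZM nsM] := inv_quotientN (center_normal _) nsMC.
have sMC': M \subset C := normal_sub nsM.
have nZM: M \subset 'N('Z(C)) := subset_trans sMC' (gFnorm _ _).
have sZZ: 'Z(C) \subset 'Z(M).
  by rewrite subsetI sZM (subset_trans _ (centS sMC')) ?subsetIr.
case/negP: ntM; rewrite /= defM -subG1 quotient_sub1 //.
apply: subset_trans sFC; rewrite Fitting_max // -quotient_center_nil abelian_nil //.
by rewrite sub_der1_abelian // (subset_trans _ sZZ) // der1_min // -defM.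
Qed.

Lemma Hall_dvd (gT : finGroupType) pi (G H : {group gT}) t :
  pi.-Hall(G) H -> prime t -> t \in pi -> (t %| #|H|) = (t %| #|G|).
Proof.
move=> hallH t_pr pi_t; apply/idP/idP=> [tH | tG].
  exact: dvdn_trans tH (cardSg (pHall_sub hallH)).
rewrite (card_Hall hallH) -(part_pnat_id (pi_pnat (pnat_id t_pr) pi_t)).
exact: partn_dvd.
Qed.

(** In a Hall {p, q, r}-subgroup, a minimal normal subgroup belongs to one of the three primes, and
    a Hall subgroup for the other two acts on it. *)
Lemma lucido (gT : finGroupType) (G : {group gT}) (p q r : nat) :
    solvable G -> prime p -> prime q -> prime r -> p != q -> q != r -> p != r ->
    p %| #|G| -> q %| #|G| -> r %| #|G| ->
  [|| has_order G (p * q), has_order G (q * r) | has_order G (p * r)].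
Proof.
move=> solG p_pr q_pr r_pr npq nqr npr p_G q_G r_G.
pose pi : nat_pred := pred3 p q r.
have [H hallH] := Hall_exists pi solG; have [sHG piH _] := and3P hallH.
have solH := solvableS sHG solG.
have ntH: H :!=: 1.
  apply: contraTneq p_G => H1; rewrite -(Hall_dvd hallH) ?inE ?eqxx //.
  by rewrite H1 cards1 gtnNdvd ?prime_gt1.
have [V [sVH nsVH ntV /is_abelemP[t t_pr abV]]] := solvable_norm_abelem solH (normal_refl H) ntH.
have tV := abelem_pgroup abV.
have: t \in pi.
  apply: (pgroupP piH) => //; have [_ t_V _] := pgroup_pdiv tV ntV.
  exact: dvdn_trans t_V (cardSg sVH).
have nVH := normal_norm nsVH.
have step u v : prime u -> prime v -> u \in pi -> v \in pi -> u != v -> u != t -> v != t ->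
    u %| #|G| -> v %| #|G| -> [|| has_order G (u * v), has_order G (u * t) | has_order G (v * t)].
  move=> u_pr v_pr pi_u pi_v nuv nut nvt u_G v_G.
  have [K hallK] := Hall_exists (pred2 u v) solH.
  have sKH := pHall_sub hallK.
  apply: (@has_order_of_action _ G K V) => //.
  - exact: solvableS solH.
  - exact: subset_trans sHG.
  - exact: subset_trans sHG.
  - exact: subset_trans nVH.
  - by rewrite (Hall_dvd hallK) ?(Hall_dvd hallH) ?inE ?eqxx.
  - by rewrite (Hall_dvd hallK) ?(Hall_dvd hallH) ?inE ?eqxx ?orbT.
  - exact: pHall_pgroup hallK.
rewrite !inE => /or3P[]/eqP def_t; subst t.
- have := step q r; rewrite (mulnC q p) (mulnC r p) !inE !eqxx ?orbT.
  rewrite (eq_sym q p) (eq_sym r p) => /(_ q_pr r_pr isT isT nqr npq npr q_G r_G).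
  by rewrite orbCA.
- have := step p r; rewrite (mulnC r q) !inE !eqxx ?orbT.
  rewrite (eq_sym r q) => /(_ p_pr r_pr isT isT npr npq nqr p_G r_G).
  by case/or3P=> ->; rewrite ?orbT.
have := step p q; rewrite !inE !eqxx ?orbT.
move=> /(_ p_pr q_pr isT isT npq npr nqr p_G q_G).
by case/or3P=> ->; rewrite ?orbT.
Qed.

(* In a solvable group whose order is divisible by two distinct primes p and q
   which are not adjacent in the prime graph, exactly one of p, q divides the
   order of the abelianization of a Hall {p, q}-subgroup. *)
Definition arrow (gT : finGroupType) (G : {group gT}) (p q : nat) : Prop :=
  [/\ prime p, prime q & p != q] /\ [/\ p %| #|G|, q %| #|G| & ~~ has_order G (p * q)]
  /\ exists2 H : {group gT}, (pred2 p q : nat_pred).-Hall(G) H & p %| #|H / H^`(1)|.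

Lemma arrow_or (gT : finGroupType) (G : {group gT}) p q :
    solvable G -> prime p -> prime q -> p != q -> p %| #|G| -> q %| #|G| ->
  ~~ has_order G (p * q) -> arrow G p q \/ arrow G q p.
Proof.
move=> solG p_pr q_pr npq p_G q_G no_pq.
have [H hallH] := Hall_exists (pred2 p q) solG.
have ntH: H :!=: 1.
  apply: contraTneq p_G => H1; rewrite -(Hall_dvd hallH) ?inE ?eqxx //.
  by rewrite H1 cards1 gtnNdvd ?prime_gt1.
have prH: H^`(1) \proper H by apply: sol_der1_proper (solvableS (pHall_sub hallH) solG) _ ntH.
have ntHb: H / H^`(1) != 1.
  by rewrite -subG1 quotient_sub1 ?der_norm //; case/andP: prH.
have [|[t t_pr t_H]] := trivgVpdiv (H / H^`(1))%G; first by move=> Hb1; case/eqP: ntHb.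
have: t \in pred2 p q by exact: (pgroupP (quotient_pgroup _ (pHall_pgroup hallH)) t t_pr t_H).
rewrite inE => /orP[]/eqP def_t; subst t; [left | right].
  by do !split=> //; exists H.
split; first by rewrite eq_sym.
split; first by rewrite mulnC.
exists H => //; rewrite -(eq_pHall _ _ (_ : pred2 p q =i pred2 q p)) // => x.
by rewrite !inE orbC.
Qed.

(** The image of the Hall subgroup is nontrivial because q survives, so its abelianization is
    nontrivial too. If q divided the order of the latter, p and q would both divide the order of the
    abelianization of [H] and be adjacent. So p divides it, and in particular p survives as well. *)
Lemma arrow_quotient (gT : finGroupType) (G N : {group gT}) p q :
    solvable G -> N <| G -> q %| #|G / N| -> arrow G p q -> arrow (G / N)%G p q.
Proof.
move=> solG nsNG q_GN [[p_pr q_pr npq] [[p_G q_G no_pq] [H hallH pHb]]].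
have [sHG piH _] := and3P hallH; have nNG := normal_norm nsNG.
have nNH := subset_trans sHG nNG.
have hallHN := quotient_pHall nNH hallH.
have ntHN: (H / N)%G :!=: 1.
  apply: contraTneq q_GN => H1; rewrite -(Hall_dvd hallHN) ?inE ?eqxx ?orbT //.
  by rewrite H1 cards1 gtnNdvd ?prime_gt1.
have prH: (H / N)^`(1) \proper H / N.
  by apply: sol_der1_proper (quotient_sol _ (solvableS sHG solG)) _ ntHN.
have ntHb: (H / N) / (H / N)^`(1) != 1.
  by rewrite -subG1 quotient_sub1 ?der_norm //; case/andP: prH.
have [|[t t_pr t_H]] := trivgVpdiv ((H / N) / (H / N)^`(1))%G; first by move=> Hb1; case/eqP: ntHb.
have: t \in pred2 p q by exact: (pgroupP (quotient_pgroup _ (pHall_pgroup hallHN)) t t_pr t_H).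
rewrite inE => /orP[]/eqP def_t; subst t; last first.
  case/negP: no_pq; apply: has_orderS sHG _; apply: (@has_order_quotient _ H H^`(1)%G).
  apply: has_order_abelian => //; first exact: der_abelian.
  apply: dvdn_trans t_H _; rewrite /= -quotient_der // !card_quotient ?quotient_norms ?der_norm //.
  by apply: index_quotient; rewrite subIset ?nNH.
have p_GN: p %| #|G / N|.
  by rewrite -(Hall_dvd hallHN) ?inE ?eqxx // (dvdn_trans t_H) ?dvdn_quotient.
do !split=> //.
  by apply: contra no_pq; apply: has_order_quotient.
by exists (H / N)%G.
Qed.

(** * Excluding directed walks of length 3 *)

Lemma der1_sub_cent_cyclic (gT : finGroupType) (G R : {group gT}) :
  G \subset 'N(R) -> cyclic R -> G^`(1) \subset 'C(R).
Proof.
move=> nRG cycR; rewrite -ker_conj_aut -sub_morphim_pre ?morphim_der //; last first.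
  exact: subset_trans (der_sub 1 G) nRG.
rewrite (sameP trivgP eqP) (sameP eqP derG1P).
exact: abelianS (Aut_conj_aut _ _) (Aut_cyclic_abelian cycR).
Qed.

Lemma dvd_quotient_p'core (gT : finGroupType) (G : {group gT}) (s : nat) :
  prime s -> s %| #|G| -> s %| #|G / 'O_s^'(G)|.
Proof.
move=> s_pr; rewrite -(Lagrange (pcore_sub s^' G)) -card_quotient ?gFnorm //.
rewrite Euclid_dvdM // => /orP[] // sO.
by have := pgroupP (pcore_pgroup s^' G) s s_pr sO; rewrite !inE eqxx.
Qed.

Lemma p'core1_Fitting (gT : finGroupType) (G : {group gT}) (s : nat) :
    solvable G -> prime s -> s %| #|G| -> 'O_s^'(G) = 1 ->
  'F(G) = 'O_s(G) /\ 'O_s(G) != 1.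
Proof.
move=> solG s_pr s_G O1; have FO := Fitting_eq_pcore O1; split=> //.
rewrite -FO trivg_Fitting //; apply: contraTneq s_G => ->.
by rewrite cards1 gtnNdvd ?prime_gt1.
Qed.

(* If the 2-rank is 1, then O_2(G) contains a central involution of G. *)
Lemma arrow_two_rank (gT : finGroupType) (G : {group gT}) q :
  solvable G -> arrow G q 2 -> 'r_2(G) <= 1 -> False.
Proof.
wlog O1: gT G / 'O_2^'(G) = 1.
  move=> IH solG q2 r2; apply: (IH _ (G / 'O_2^'(G))%G).
  - exact: trivg_pcore_quotient.
  - exact: quotient_sol.
  - apply: arrow_quotient => //; first exact: pcore_normal.
    by apply: dvd_quotient_p'core => //; case: q2 => _ [[]].
  by rewrite p_rank_p'quotient ?pcore_pgroup ?gFnorm.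
move=> solG [[q_pr _ q_neq2] [[q_G two_G no_q2] _]] r2.
have [_ ntO] := p'core1_Fitting solG (isT : prime 2) two_G O1.
have O2: 2.-group 'O_2(G) := pcore_pgroup _ _.
have ZO2: 2.-group 'Z('O_2(G)) := pgroupS (center_sub _) O2.
pose Z := 'Ohm_1('Z('O_2(G)))%G.
have abZ: 2.-abelem Z by apply: Ohm1_abelem; rewrite ?center_abelian.
have nsZG: Z <| G.
  apply: char_normal_trans (pcore_normal 2 G).
  exact: char_trans (Ohm_char _ _) (center_char _).
have ntZ: Z :!=: 1.
  by rewrite /= Ohm1_eq1 center_nil_eq1 ?(pgroup_nil O2).
have oZ: #|Z| = 2.
  have [_ _ [m oZ]] := pgroup_pdiv (abelem_pgroup abZ) ntZ.
  have: logn 2 #|Z| <= 1.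
    by rewrite -p_rank_abelem // (leq_trans (p_rankS _ (normal_sub nsZG))).
  by rewrite oZ pfactorK //; case: m {oZ}.
have [z Zz oz] := Cauchy (isT : prime 2) (eq_ind_r (fun n => 2 %| n) (isT : 2 %| 2) oZ).
have [y Gy oy] := Cauchy q_pr q_G.
case/negP: no_q2; rewrite -oy -oz; apply: has_order_mul => //.
- exact: subsetP (normal_sub nsZG) z Zz.
- have defZ: Z :=: <[z]> by apply/esym/eqP; rewrite eqEcard cycle_subG Zz -orderE oz oZ.
  have ntz: z != 1 by rewrite -order_gt1 oz.
  apply/commute_sym/commgP/conjg_fixP.
  have: z ^ y \in Z by rewrite memJ_norm // (subsetP (normal_norm nsZG)).
  rewrite defZ => /cycleP[i]; rewrite -(expg_mod_order) oz.
  case: (i %% 2) (ltn_pmod i (isT : 0 < 2)) => [|[|//]] _ //.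
  by move/eqP; rewrite expg0 conjg_eq1 (negPf ntz).
by rewrite oy oz prime_coprimeE.
Qed.

Lemma no_arrow_walk (gT : finGroupType) (G : {group gT}) p q r s :
  solvable G -> arrow G p q -> arrow G q r -> arrow G r s -> False.
Proof.
wlog O1: gT G / 'O_s^'(G) = 1.
  move=> IH solG pq qr rs; have nsO: 'O_s^'(G) <| G := pcore_normal _ _.
  (* The arrows descend from the last to the first: s survives in the quotient, hence so do r, q and
     p in turn. *)
  have rs': arrow (G / 'O_s^'(G))%G r s.
    by apply: arrow_quotient; rewrite ?dvd_quotient_p'core //; case: rs => [[]] // _ _ _ [[]].
  have qr': arrow (G / 'O_s^'(G))%G q r.
    by apply: arrow_quotient => //; case: rs' => _ [[]].
  have pq': arrow (G / 'O_s^'(G))%G p q.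
    by apply: arrow_quotient => //; case: qr' => _ [[]].
  by apply: IH pq' qr' rs'; [apply: trivg_pcore_quotient | apply: quotient_sol].
move=> solG pq qr [[r_pr s_pr nrs] [[r_G s_G no_rs] _]].
have [_ ntO] := p'core1_Fitting solG s_pr s_G O1.
have [R sylR] := Sylow_exists r G; have [sRG rR _] := and3P sylR.
have r1 : 'r_r(R) <= 1.
  apply: (p_rank1_of_free r_pr nrs sRG (pcore_sub s G)) no_rs => //.
  - exact: subset_trans sRG (gFnorm _ _).
  - exact: pcore_pgroup.
(* Rank 1 implies cyclic only for odd r; for r = 2 the Sylow subgroup may be generalized
   quaternion. *)
have [r2 | odd_r] := even_prime r_pr.
  subst r; apply: (arrow_two_rank solG qr).
  by rewrite -(p_rank_Sylow sylR).
have cycR: cyclic R by rewrite (odd_pgroup_rank1_cyclic rR) // (odd_pgroup_odd odd_r).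
pose N := 'O_r^'(G); pose K := (G / N)%G.
have nsN: N <| G := pcore_normal _ _.
have solK: solvable K := quotient_sol _ solG.
have r_K: r %| #|K| by apply: dvd_quotient_p'core.
have qrK: arrow K q r by apply: arrow_quotient.
have q_K: q %| #|K| by case: qrK => _ [[]].
have pqK: arrow K p q by apply: arrow_quotient.
have [FO _] := p'core1_Fitting solK r_pr r_K (trivg_pcore_quotient _ _).
have cycO: cyclic 'O_r(K).
  have sylRb := quotient_pHall (subset_trans sRG (normal_norm nsN)) sylR.
  apply: cyclicS (pcore_sub_Hall sylRb) (quotient_cyclic _ cycR).
have nsOK: 'O_r(K) <| K := pcore_normal _ _.
have abK: abelian (K / 'O_r(K)).
  (* The derived subgroup of [K] centralizes the cyclic group 'F(K), hence lies in it. *)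
  apply: sub_der1_abelian; rewrite /= -FO; apply: subset_trans (cent_Fitting_sub solK).
  by rewrite subsetI der_sub FO der1_sub_cent_cyclic ?normal_norm.
have q_KO : q %| #|K / 'O_r(K)|.
  have [[q_pr _ nqr] _] := qrK.
  move: q_K; rewrite -(Lagrange (normal_sub nsOK)) -card_quotient ?normal_norm //.
  rewrite Euclid_dvdM // => /orP[] // qO.
  have := pgroupP (pcore_pgroup r K) q q_pr qO.
  by rewrite inE (negPf nqr).
(* Since q survives modulo 'O_r(K), the arrow brings p along, and two primes dividing the order of
   an abelian group are adjacent. *)
have [[p_pr q_pr npq] [[p_KO _ no_pq] _]] := arrow_quotient solK nsOK q_KO pqK.
by case/negP: no_pq; apply: has_order_abelian.
Qed.

Lemma no_walk_coloring (T : finType) (e : rel T) :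
    (forall x y z t, e x y -> e y z -> e z t -> False) ->
  exists c : T -> 'I_3, forall x y, e x y -> c x != c y.
Proof.
move=> no3; pose s x := [exists y, e x y]; pose s2 x := [exists y, e x y && s y].
(* Along an edge from x to y, [s x] holds and [s2 y] fails, while [s y] forces [s2 x]; so the sum
   drops. *)
exists (fun x => inord (s x + s2 x)) => x y exy.
have sx : s x by apply/existsP; exists y.
have s2y : s2 y = false.
  apply/existsP=> [[z /andP[eyz /existsP[t ezt]]]]; exact: no3 exy eyz ezt.
rewrite -val_eqE /= !inordK ?sx ?s2y ?addn0; try by case: (s _); case: (s2 _).
have [sy | //] := boolP (s y).
by have ->: s2 x by apply/existsP; exists y; rewrite exy sy.
Qed.

(** The boolean form makes [arrow] a relation on a finite type, to which [no_walk_coloring]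
    applies. *)
Definition arrowb (gT : finGroupType) (G : {group gT}) (p q : nat) :=
  [&& [&& prime p, prime q & p != q], [&& p %| #|G|, q %| #|G| & ~~ has_order G (p * q)]
    & [exists H : {group gT}, (pred2 p q : nat_pred).-Hall(G) H && (p %| #|H / H^`(1)|)]].

Lemma arrowP (gT : finGroupType) (G : {group gT}) p q :
  reflect (arrow G p q) (arrowb G p q).
Proof.
apply: (iffP and3P) => [[/and3P a1 /and3P a2 /existsP[H /andP[h1 h2]]] | [a1 [a2 [H h1 h2]]]].
  by do 2!split=> //; exists H.
by split; [apply/and3P | apply/and3P | apply/existsP; exists H; rewrite h1 h2].
Qed.

Theorem solvable_coloring (gT : finGroupType) (G : {group gT}) :
    solvable G ->
  exists c : nat -> 'I_3, forall p q, prime p -> prime q -> p != q ->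
    p %| #|G| -> q %| #|G| -> ~~ has_order G (p * q) -> c p != c q.
Proof.
move=> solG; pose e : rel 'I_#|G|.+1 := [rel p q : 'I_#|G|.+1 | arrowb G p q].
have [|c cP] := @no_walk_coloring _ e.
  by move=> p q r s /arrowP pq /arrowP qr /arrowP rs; apply: no_arrow_walk pq qr rs.
exists (fun n => c (inord n)) => p q p_pr q_pr npq p_G q_G no_pq.
have ltG n : n %| #|G| -> n < #|G|.+1 by rewrite ltnS => /dvdn_leq->.
have [a | a] := arrow_or solG p_pr q_pr npq p_G q_G no_pq; last rewrite eq_sym;
  by apply: cP; apply/arrowP; rewrite !inordK ?ltG.
Qed.

(** * Elements of SU_3(3) *)

(* None, Some true and Some false encode 0, 1 and -1 in F_3, and a pair (a, b)
   encodes a + b i, where i ^+ 2 = -1. *)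
Definition c3 := option bool.
Definition c9 := (c3 * c3)%type.

Definition opp3 (a : c3) : c3 := omap negb a.
Definition add3 (a b : c3) : c3 :=
  match a, b with
  | None, _ => b
  | _, None => a
  | Some true, Some true => Some false
  | Some false, Some false => Some true
  | _, _ => None
  end.
Definition mul3 (a b : c3) : c3 :=
  match a, b with
  | Some x, Some y => Some (x == y)
  | _, _ => None
  end.

Definition add9 (x y : c9) : c9 := (add3 x.1 y.1, add3 x.2 y.2).
Definition opp9 (x : c9) : c9 := (opp3 x.1, opp3 x.2).
Definition mul9 (x y : c9) : c9 :=
  (add3 (mul3 x.1 y.1) (opp3 (mul3 x.2 y.2)), add3 (mul3 x.1 y.2) (mul3 x.2 y.1)).
Definition conj9 (x : c9) : c9 := (x.1, opp3 x.2).
Definition zero9 : c9 := (None, None).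
Definition one9 : c9 := (Some true, None).
Definition i9 : c9 := (None, Some true).

Definition all3 : seq c3 := [:: None; Some true; Some false].
Definition all9 : seq c9 := [seq (a, b) | a <- all3, b <- all3].

Definition cV := (c9 * c9 * c9)%type.
Definition cM := (cV * cV * cV)%type.

Definition allV : seq cV := [seq (xy, z) | xy <- [seq (x, y) | x <- all9, y <- all9], z <- all9].

Definition sum3 (x y z : c9) := add9 x (add9 y z).
Definition herm (u v : cV) : c9 :=
  sum3 (mul9 u.1.1 (conj9 v.1.1)) (mul9 u.1.2 (conj9 v.1.2)) (mul9 u.2 (conj9 v.2)).
Definition det3 (A : cM) : c9 :=
  let: (u, v, w) := A in
  let: (a, b, c) := u in let: (d, e, f) := v in let: (g, h, i) := w in
  sum3 (mul9 a (add9 (mul9 e i) (opp9 (mul9 f h))))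
       (opp9 (mul9 b (add9 (mul9 d i) (opp9 (mul9 f g)))))
       (mul9 c (add9 (mul9 d h) (opp9 (mul9 e g)))).
Definition vmul (u : cV) (B : cM) : cV :=
  (sum3 (mul9 u.1.1 B.1.1.1.1) (mul9 u.1.2 B.1.2.1.1) (mul9 u.2 B.2.1.1),
   sum3 (mul9 u.1.1 B.1.1.1.2) (mul9 u.1.2 B.1.2.1.2) (mul9 u.2 B.2.1.2),
   sum3 (mul9 u.1.1 B.1.1.2) (mul9 u.1.2 B.1.2.2) (mul9 u.2 B.2.2)).
Definition mmul (A B : cM) : cM := (vmul A.1.1 B, vmul A.1.2 B, vmul A.2 B).
Definition mone : cM := ((one9, zero9, zero9), (zero9, one9, zero9), (zero9, zero9, one9)).

(** A unitary matrix is an orthonormal frame of rows. Choosing the rows among unit vectors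
    orthogonal to the first one keeps the search far below the 9 ^ 9 matrices. *)
Definition units : seq cV := [seq v <- allV | herm v v == one9].
Definition perp (u : cV) := [seq v <- units | herm u v == zero9].
Definition frames (u : cV) : seq (cV * cV) :=
  let s := perp u in
  [seq vw <- [seq (v, w) | v <- s, w <- s] |
    (herm vw.1 vw.2 == zero9) && (det3 (u, vw.1, vw.2) == one9)].
Definition listSU : seq cM := [seq (u, vw.1, vw.2) | u <- units, vw <- frames u].
Definition order6 (A : cM) :=
  let A2 := mmul A A in let A3 := mmul A A2 in
  [&& A2 != mone, A3 != mone & mmul A3 A3 == mone].

Local Open Scope ring_scope.

(** * The coded arithmetic and the field with nine elements *)

Lemma three_F9 : 3%:R = 0 :> F9.
Proof. exact: pcharf0 F9_pchar. Qed.

Lemma exists_sqrtN1 : exists x : F9, x * x == -1.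
Proof.
have unity (x : F9) : x != 0 -> x ^+ 8 = 1.
  move=> nz_x; have := expf_card x; rewrite card_F9 exprS => /eqP.
  by rewrite -subr_eq0 -{3}[x]mulr1 -mulrBr mulf_eq0 (negPf nz_x) subr_eq0 => /eqP.
have /hasP[z _ prim_z]: has 8.-primitive_root (enum (predC1 (0 : F9))).
  apply: has_prim_root; rewrite ?enum_uniq //.
    by apply/allP=> x; rewrite mem_enum => /unity/unity_rootP.
  by rewrite -cardE cardC1 card_F9.
(* For a primitive 8th root of unity z, z ^+ 4 is a square root of 1 other than 1. *)
exists (z ^+ 2); rewrite -exprD.
have: (z ^+ 4 == 1) || (z ^+ 4 == -1).
  by rewrite -sqrf_eq1 -exprM (prim_expr_order prim_z).
by rewrite -(prim_order_dvd prim_z).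
Qed.

Definition im9 : F9 := xchoose exists_sqrtN1.

Lemma im9_sq : im9 * im9 = -1.
Proof. exact/eqP/(xchooseP exists_sqrtN1). Qed.

Definition val3 (a : c3) : F9 := if a is Some b then (if b then 1 else -1) else 0.
Definition val9 (x : c9) : F9 := val3 x.1 + val3 x.2 * im9.

Lemma add3E a b : val3 (add3 a b) = val3 a + val3 b.
Proof.
have h : 1 + 1 = -1 :> F9.
  by apply/eqP; rewrite -subr_eq0 opprK -[X in _ == X]three_F9; apply/eqP; ring.
by case: a b => [[]|] [[]|] /=; rewrite ?add0r ?addr0 ?subrr ?addNr -?opprD ?h ?opprK.
Qed.

Lemma opp3E a : val3 (opp3 a) = - val3 a.
Proof. by case: a => [[]|] /=; rewrite ?oppr0 ?opprK. Qed.

Lemma mul3E a b : val3 (mul3 a b) = val3 a * val3 b.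
Proof. by case: a b => [[]|] [[]|] /=; rewrite ?mulr0 ?mul0r ?mulr1 ?mul1r ?mulrNN ?mulr1. Qed.

Lemma add9E x y : val9 (add9 x y) = val9 x + val9 y.
Proof. by rewrite /val9 /= !add3E; ring. Qed.

Lemma opp9E x : val9 (opp9 x) = - val9 x.
Proof. by rewrite /val9 /= !opp3E; ring. Qed.

Lemma mul9E x y : val9 (mul9 x y) = val9 x * val9 y.
Proof.
rewrite /val9 /= !add3E !opp3E !mul3E.
set a := val3 _; set b := val3 _; set c := val3 _; set d := val3 _.
transitivity (a * b + (c * d) * (im9 * im9) + (a * d + c * b) * im9); last by ring.
by rewrite im9_sq; ring.
Qed.

Lemma conj9E x : val9 (conj9 x) = bar9 (val9 x).
Proof.
have bari : bar9 im9 = - im9.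
  by rewrite -[LHS]/(im9 ^+ 3) !exprS expr0 mulr1 im9_sq mulrN1.
have bar3 a : bar9 (val3 a) = val3 a.
  by case: a => [[]|] /=; rewrite ?rmorphN ?rmorph1 ?rmorph0.
by rewrite /val9 /= rmorphD rmorphM /= bari !bar3 opp3E mulNr mulrN.
Qed.

(** The norm a ^+ 2 + b ^+ 2 of a + b i has no nontrivial zero over F_3. *)
Lemma val9_eq0 x : val9 x = 0 -> x = zero9.
Proof.
move=> x0; have: val9 (mul9 x (conj9 x)) = 0 by rewrite mul9E x0 mul0r.
have n1 : -1 != 0 :> F9 by rewrite oppr_eq0 oner_eq0.
by case: x x0 => [[[]|] [[]|]] _; rewrite /val9 /= ?mul0r ?addr0 => /eqP;
  rewrite ?(negPf n1) ?oner_eq0.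
Qed.

Lemma val9_inj : injective val9.
Proof.
move=> x y eq_xy; have: val9 (add9 x (opp9 y)) = 0 by rewrite add9E opp9E eq_xy subrr.
move/val9_eq0; case: x y {eq_xy} => [a b] [c d] [].
by case: a c => [[]|] [[]|] // _; case: b d => [[]|] [[]|].
Qed.

Lemma val9_surj z : exists x, z = val9 x.
Proof.
have: #|codom val9| = #|F9|.
  by rewrite (card_codom val9_inj) card_F9 card_prod card_option card_bool.
move/subset_cardP/(_ (subset_predT _))/(_ z); rewrite inE => /imageP[x _ ->].
by exists x.
Qed.

Lemma mem_all9 x : x \in all9.
Proof. by case: x => [[[]|] [[]|]]. Qed.

Lemma mem_allV u : u \in allV.
Proof.
case: u => [[x y] z]; apply/allpairsP; exists ((x, y), z); split; rewrite ?mem_all9 //.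
by apply/allpairsP; exists (x, y); split; rewrite ?mem_all9.
Qed.

Definition sel (T : Type) (t : T * T * T) (i : nat) : T :=
  match i with 0 => t.1.1 | 1 => t.1.2 | _ => t.2 end.

Definition mx9 (A : cM) : 'M[F9]_3 := \matrix_(i < 3, j < 3) val9 (sel (sel A i) j).

(** The indices are written as lifts of [ord0], the form in which [big_ord_recl] produces them. *)
Lemma ord3P (P : 'I_3 -> Prop) :
  P ord0 -> P (lift ord0 ord0) -> P (lift ord0 (lift ord0 ord0)) -> forall i, P i.
Proof.
move=> P0 P1 P2 [[|[|[|//]]] lt_i].
- by rewrite (_ : Ordinal _ = ord0) //; apply: val_inj.
- by rewrite (_ : Ordinal _ = lift ord0 ord0) //; apply: val_inj.
by rewrite (_ : Ordinal _ = lift ord0 (lift ord0 ord0)) //; apply: val_inj.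
Qed.

Lemma mx9_mul A B : mx9 (mmul A B) = mx9 A *m mx9 B.
Proof.
apply/matrixP; apply: ord3P; apply: ord3P;
  by rewrite !mxE !big_ord_recl big_ord0 !mxE /= !add9E !mul9E addr0.
Qed.

Lemma mx9_one : mx9 mone = 1%:M.
Proof.
by apply/matrixP; apply: ord3P; apply: ord3P; rewrite !mxE /= /val9 /= mul0r addr0.
Qed.

Lemma mx9_inj : injective mx9.
Proof.
move=> [[[[a b] c] [[d e] f]] [[g h] k]] [[[[a' b'] c'] [[d' e'] f']] [[g' h'] k']] eqA.
have eq_ij (i j : 'I_3) : mx9 _ i j = _ := congr1 (fun M : 'M_3 => M i j) eqA.
pose o1 : 'I_3 := lift ord0 ord0; pose o2 : 'I_3 := lift ord0 (lift ord0 ord0).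
have E i j := etrans (esym (mxE _ _ _ _)) (etrans (eq_ij i j) (mxE _ _ _ _)).
move: (val9_inj (E ord0 ord0)) (val9_inj (E ord0 o1)) (val9_inj (E ord0 o2)) => /= -> -> ->.
move: (val9_inj (E o1 ord0)) (val9_inj (E o1 o1)) (val9_inj (E o1 o2)) => /= -> -> ->.
by move: (val9_inj (E o2 ord0)) (val9_inj (E o2 o1)) (val9_inj (E o2 o2)) => /= -> -> ->.
Qed.

Lemma mx9_surj (M : 'M[F9]_3) : exists A, M = mx9 A.
Proof.
pose o1 : 'I_3 := lift ord0 ord0; pose o2 : 'I_3 := lift ord0 (lift ord0 ord0).
have [a ha] := val9_surj (M ord0 ord0); have [b hb] := val9_surj (M ord0 o1).
have [c hc] := val9_surj (M ord0 o2); have [d hd] := val9_surj (M o1 ord0).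
have [e he] := val9_surj (M o1 o1); have [f hf] := val9_surj (M o1 o2).
have [g hg] := val9_surj (M o2 ord0); have [h hh] := val9_surj (M o2 o1).
have [k hk] := val9_surj (M o2 o2).
exists ((a, b, c), (d, e, f), (g, h, k)); apply/matrixP.
by apply: ord3P; apply: ord3P; rewrite mxE.
Qed.

Lemma det3E A : \det (mx9 A) = val9 (det3 A).
Proof.
case: A => [[[[a b] c] [[d e] f]] [[g h] i]].
rewrite (expand_det_row _ ord0) !big_ord_recl big_ord0 /cofactor.
rewrite !(expand_det_row _ ord0) !big_ord_recl !big_ord0 /cofactor !det_mx11 !mxE /=.
rewrite /sum3 !add9E !mul9E !opp9E !mul9E !add9E !opp9E !mul9E /bump /=.
by ring.
Qed.

Lemma mx9_hermE A i j :
  (mx9 A *m (map_mx bar9 (mx9 A))^T) i j = val9 (herm (sel A i) (sel A j)).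
Proof.
by rewrite !mxE !big_ord_recl big_ord0 !mxE /= !add9E !mul9E !conj9E addr0.
Qed.

Lemma conj9K : involutive conj9.
Proof. by case=> [[[]|] [[]|]]. Qed.

Lemma herm_sym u v : herm v u = conj9 (herm u v).
Proof.
apply: val9_inj; rewrite conj9E /herm /sum3 !add9E !mul9E !rmorphD !rmorphM /= -!conj9E !conj9K.
by congr (_ + (_ + _)); rewrite mulrC.
Qed.

(** Only the Gram entries on and above the diagonal are tested; those below follow by [herm_sym]. *)
Definition unitary9 (A : cM) :=
  [&& herm A.1.1 A.1.1 == one9, herm A.1.2 A.1.2 == one9, herm A.2 A.2 == one9,
      herm A.1.1 A.1.2 == zero9, herm A.1.1 A.2 == zero9 & herm A.1.2 A.2 == zero9]
  && (det3 A == one9).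

Lemma mem_listSU A : (A \in listSU) = unitary9 A.
Proof.
apply/allpairsPdep/idP => [[u [[v w] /= []]] | ].
  rewrite !mem_filter /= => /andP[uu _] /andP[/andP[vw det] /allpairsP[[v' w'] /= []]].
  rewrite !mem_filter => /and3P[uv vv _] /and3P[uw ww _] [def_v def_w] ->; subst v' w'.
  by rewrite /unitary9 /= uu vv ww uv uw vw det.
case: A => [[u v] w]; rewrite /unitary9 /= => /andP[/and5P[uu vv ww uv /andP[uw vw]] det].
exists u, (v, w); rewrite mem_filter uu mem_allV mem_filter /= vw det; split=> //.
by apply/allpairsP; exists (v, w); rewrite !mem_filter /= uv uw vv ww !mem_allV.
Qed.

Lemma uniq_listSU : uniq listSU.
Proof.
have uniq9 : uniq all9 by [].
have uniqV : uniq allV.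
  by apply: allpairs_uniq => // [[? ?] [? ?] _ _ [-> ->]].
apply: allpairs_uniq_dep => [|u _|].
- exact: filter_uniq.
- have Uu : uniq (perp u) by apply: filter_uniq; apply: filter_uniq uniqV.
  apply: filter_uniq; apply: (allpairs_uniq Uu Uu).
  by move=> [v w] [v' w'] _ _ [-> ->].
by move=> [? [? ?]] [? [? ?]] _ _ /= [-> -> ->].
Qed.

Lemma val9_one : val9 one9 = 1.
Proof. by rewrite /val9 /= mul0r addr0. Qed.

Lemma val9_zero : val9 zero9 = 0.
Proof. by rewrite /val9 /= mul0r addr0. Qed.

Lemma val9_eq1 x : (val9 x == 1) = (x == one9).
Proof. by rewrite -val9_one (inj_eq val9_inj). Qed.

Lemma val9_eq0E x : (val9 x == 0) = (x == zero9).
Proof. by rewrite -val9_zero (inj_eq val9_inj). Qed.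

Arguments herm : simpl never.
Arguments val9 : simpl never.

Lemma unitary9E A :
  unitary9 A = ((mx9 A *m (map_mx bar9 (mx9 A))^T == 1%:M) && (\det (mx9 A) == 1)).
Proof.
rewrite /unitary9 det3E val9_eq1; congr (_ && _).
pose o1 : 'I_3 := lift ord0 ord0; pose o2 : 'I_3 := lift ord0 (lift ord0 ord0).
apply/and5P/eqP => [[uu vv ww uv /andP[uw vw]] | eq1].
  have conj0 : conj9 zero9 = zero9 by [].
  move: uu vv ww uv uw vw => /eqP uu /eqP vv /eqP ww /eqP uv /eqP uw /eqP vw.
  apply/matrixP; apply: ord3P; apply: ord3P; rewrite mx9_hermE mxE /=;
    first [by rewrite uu val9_one | by rewrite vv val9_one | by rewrite ww val9_one
      | by rewrite uv val9_zero | by rewrite uw val9_zero | by rewrite vw val9_zero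
      | by rewrite (herm_sym A.1.1) uv conj0 val9_zero | by rewrite (herm_sym A.1.1) uw conj0 val9_zero
      | by rewrite (herm_sym A.1.2) vw conj0 val9_zero].
have E (i j : 'I_3) : val9 (herm (sel A i) (sel A j)) = (i == j)%:R by rewrite -mx9_hermE eq1 mxE.
by split; [ | | | | apply/andP; split]; rewrite -?val9_eq1 -?val9_eq0E;
  [rewrite (E ord0 ord0) | rewrite (E o1 o1) | rewrite (E o2 o2) | rewrite (E ord0 o1)
  | rewrite (E ord0 o2) | rewrite (E o1 o2)].
Qed.

Opaque mmul unitary9 mx9 listSU.

(* Naming the type and the group fixes the instance path of the group
   operations, which makes their unification immediate. *)
Definition GL9 : finGroupType := {'GL_3[F9]}.
Definition SU9 : {group GL9} := SU33.

Definition mx_of (g : GL9) : 'M[F9]_3 := GLval g.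

Lemma mx_of_inj : injective mx_of.
Proof. exact: val_inj. Qed.

Lemma mx_ofM (g h : GL9) : mx_of (g * h)%g = mx_of g *m mx_of h.
Proof. exact (@GL_MxE 3 F9 g h). Qed.

Lemma mx_of1 : mx_of 1%g = 1%:M.
Proof. exact (@GL_1E 3 F9). Qed.

Lemma in_SU9 g :
  (g \in SU9) = ((mx_of g *m (map_mx bar9 (mx_of g))^T == 1%:M) && (\det (mx_of g) == 1)).
Proof. exact: in_set. Qed.

(** A singular matrix is sent to 1. Unitary matrices are invertible, so [gl9K] recovers them. *)
Definition gl9 (A : cM) : GL9 := insubd (1%g : {'GL_3[F9]}) (mx9 A).

Lemma gl9K A : unitary9 A -> mx_of (gl9 A) = mx9 A.
Proof.
rewrite unitary9E => /andP[_ /eqP det1]; rewrite /mx_of /gl9 insubdK //.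
by rewrite [_ \in _]unitmxE det1 unitr1.
Qed.

Lemma gl9_SU A : unitary9 A -> gl9 A \in SU33.
Proof. by move=> LA; rewrite in_SU9 gl9K // -unitary9E. Qed.

Lemma SU9_gl9 g : g \in SU9 -> exists2 A, unitary9 A & g = gl9 A.
Proof.
have [A defA] := mx9_surj (mx_of g).
rewrite in_SU9 defA -unitary9E => LA; exists A => //.
by apply: mx_of_inj; rewrite gl9K.
Qed.

Lemma gl9_inj A B : unitary9 A -> unitary9 B -> gl9 A = gl9 B -> A = B.
Proof.
by move=> LA LB eqAB; apply: mx9_inj; rewrite -(gl9K LA) -(gl9K LB) eqAB.
Qed.

Lemma gl9M A B : unitary9 A -> unitary9 B -> (gl9 A * gl9 B)%g = gl9 (mmul A B).
Proof.
move=> LA LB; have := groupM (gl9_SU LA) (gl9_SU LB).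
case/SU9_gl9=> C LC defC; apply: (etrans defC); apply: (congr1 gl9); apply: mx9_inj.
by rewrite -(gl9K LC) -defC mx_ofM (gl9K LA) (gl9K LB) mx9_mul.
Qed.

Lemma unitary9_mul A B : unitary9 A -> unitary9 B -> unitary9 (mmul A B).
Proof.
move=> LA LB; have := groupM (gl9_SU LA) (gl9_SU LB).
case/SU9_gl9=> C LC defC; suff ->: mmul A B = C by [].
by apply: mx9_inj; rewrite -(gl9K LC) -defC mx_ofM !gl9K // mx9_mul.
Qed.

Lemma unitary9_one : unitary9 mone.
Proof. by vm_compute. Qed.

Lemma gl9_1 : gl9 mone = 1%g.
Proof.
by apply: mx_of_inj; rewrite (gl9K unitary9_one) mx9_one mx_of1.
Qed.

Lemma gl9_eq1 A : unitary9 A -> (gl9 A == 1%g) = (A == mone).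
Proof.
move=> LA; rewrite -gl9_1; apply/eqP/eqP=> [|->//].
exact: gl9_inj LA unitary9_one.
Qed.

(** Turns a cardinality in [SU33] into a count over a list, which can be evaluated. *)
Lemma card_SU9_sub (P : pred GL9) :
  #|[set g in SU33 | P g]| = count (fun A => P (gl9 A)) listSU.
Proof.
rewrite -size_filter -(size_map gl9) -(card_uniqP _); last first.
  rewrite map_inj_in_uniq; first exact: filter_uniq uniq_listSU.
  move=> A B; rewrite !mem_filter !mem_listSU => /andP[_ LA] /andP[_ LB]; exact: gl9_inj.
apply: eq_card => g; rewrite inE; apply/andP/mapP => [[/SU9_gl9[A LA ->] PA] | [A]].
  by exists A; rewrite ?mem_filter ?mem_listSU ?PA.
by rewrite mem_filter mem_listSU => /andP[PA LA] ->; rewrite gl9_SU.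
Qed.

Lemma order6E (gT : finGroupType) (x : gT) :
  (#[x]%g == 6%N) = [&& (x ^+ 2 != 1)%g, (x ^+ 3 != 1)%g & (x ^+ 6 == 1)%g].
Proof.
rewrite -!order_dvdn; apply/eqP/and3P => [-> // | [n2 n3]].
by rewrite dvdn_divisors // !inE => /or4P[] /eqP ox; rewrite ox in n2 n3 *.
Qed.

Lemma order6_gl9 A : unitary9 A -> (#[gl9 A]%g == 6%N) = order6 A.
Proof.
move=> LA; have LA2 := unitary9_mul LA LA; have LA3 := unitary9_mul LA LA2.
have LA6 := unitary9_mul LA3 LA3.
have e2 : (gl9 A ^+ 2 = gl9 (mmul A A))%g by exact: gl9M.
have e3 : (gl9 A ^+ 3 = gl9 (mmul A (mmul A A)))%g by rewrite expgS e2 gl9M.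
have e6 : (gl9 A ^+ 6 = gl9 (mmul (mmul A (mmul A A)) (mmul A (mmul A A))))%g.
  by rewrite (expgD _ 3 3) e3 gl9M.
by rewrite order6E /order6 e2 e3 e6 (gl9_eq1 LA2) (gl9_eq1 LA3) (gl9_eq1 LA6).
Qed.

Definition commM (A B : cM) := mmul A B == mmul B A.
Definition diag9 (a b c : c9) : cM :=
  ((a, zero9, zero9), (zero9, b, zero9), (zero9, zero9, c)).
Definition perm9 : cM :=
  ((zero9, one9, zero9), (zero9, zero9, one9), (one9, zero9, zero9)).
(* The transvection 1 + i J, where J is the all-one matrix and J ^+ 2 = 0. *)
Definition transv9 : cM :=
  let d := add9 one9 i9 in ((d, i9, i9), (i9, d, i9), (i9, i9, d)).

(** The last conjunct yields the trivial center: a matrix commuting with a diagonal matrix with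
    distinct entries is diagonal, one that also commutes with a cyclic permutation is scalar, and 1
    is the only cube root of 1 in characteristic 3. *)
Lemma listSU_facts :
  [&& size listSU == (2 ^ 5 * 3 ^ 3 * 7)%N, count order6 listSU == 504%N
    & all (fun A => commM A perm9 && commM A (diag9 i9 (opp9 i9) one9) ==> (A == mone)) listSU].
Proof. by vm_compute. Qed.

Local Close Scope ring_scope.
Local Open Scope group_scope.

Lemma gl9_commute A B :
  unitary9 A -> unitary9 B -> commM A B <-> commute (gl9 A) (gl9 B).
Proof.
move=> LA LB; rewrite /commute !gl9M //; split=> [/eqP-> // | ].
by move/(gl9_inj (unitary9_mul LA LB) (unitary9_mul LB LA)) => eqAB; apply/eqP.
Qed.

Lemma center_SU9 : 'Z(SU9) = 1.
Proof.
apply/trivgP/subsetP=> g /centerP[/SU9_gl9[A LA ->] cA].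
have /and3P[_ _ /allP/(_ A)] := listSU_facts; rewrite mem_listSU => /(_ LA)/implyP cA1.
have Lp : unitary9 (perm9) by vm_compute.
have Ld : unitary9 (diag9 i9 (opp9 i9) one9) by vm_compute.
rewrite inE gl9_eq1 // cA1 //; apply/andP; split; apply/gl9_commute => //;
  by apply: cA; apply: gl9_SU.
Qed.

(** All that is used of U_3(3), in a form that isomorphisms preserve. Commuting elements of order 4
    with different squares are required, rather than commuting involutions, because the facts must
    exclude a section of a group with Sylow 2-subgroups of rank 1, and a quaternion group has a
    quotient of type 2 x 2. *)
Definition U33_facts (gT : finGroupType) (T : {group gT}) : Prop :=
  [/\ #|T| = (2 ^ 5 * 3 ^ 3 * 7)%N, #|[set x in T | #[x] == 6]| = 504,
      exists a b, [/\ [/\ a \in T, b \in T & commute a b], #[a] = 4, #[b] = 4 & a ^+ 2 != b ^+ 2]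
    & exists a b, [/\ [/\ a \in T, b \in T & commute a b], #[a] = 3, #[b] = 3 & b \notin <[a]>]].

Lemma U33_facts_isog (aT rT : finGroupType) (A : {group aT}) (B : {group rT}) :
  A \isog B -> U33_facts A -> U33_facts B.
Proof.
case/isogP=> f injf defB [oA o6 [a [b [[Aa Ab cab] oa ob nab]]] [c [d [[Ac Ad ccd] oc od ncd]]]].
have fB x : x \in A -> f x \in B by move=> Ax; rewrite -defB mem_morphim.
have ford x : x \in A -> #[f x] = #[x] by move=> Ax; apply: (order_injm injf).
split.
- by rewrite -defB card_injm.
- rewrite -o6 -(card_in_imset (f := f) (D := [set x in A | #[x] == 6])); last first.
    by move=> x y; rewrite !inE => /andP[Ax _] /andP[Ay _]; apply: (injmP injf).
  apply: eq_card => y; rewrite inE; apply/andP/imsetP=> [[] | [x]].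
    rewrite -defB => /morphimP[x _ Ax ->] o; exists x => //.
    by rewrite inE Ax -ford.
  by rewrite inE => /andP[Ax ox] ->; rewrite fB // ford.
- exists (f a), (f b); rewrite !ford // oa ob; split=> //.
    by split; rewrite ?fB // /commute -!morphM // cab.
  by rewrite -!morphX //; apply: contra nab => /eqP/(injmP injf)-> //; apply: groupX.
exists (f c), (f d); rewrite !ford // oc od; split=> //.
  by split; rewrite ?fB // /commute -!morphM // ccd.
rewrite -morphim_cycle //; apply: contra ncd => /morphimP[x Ax cx] /(injmP injf) -> //.
Qed.

Lemma gl9X n A : unitary9 A ->
  gl9 A ^+ n = gl9 (iter n (mmul A) mone) /\ unitary9 (iter n (mmul A) mone).
Proof.
move=> LA; elim: n => [|n [IHn Ln]].
  split; last exact: unitary9_one.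
  exact: etrans (expg0 _) (esym gl9_1).
rewrite expgS IHn iterS; split.
  exact: gl9M LA Ln.
exact: unitary9_mul LA Ln.
Qed.

Lemma order4I (gT : finGroupType) (x : gT) : x ^+ 4 == 1 -> x ^+ 2 != 1 -> #[x] = 4.
Proof. by rewrite -!order_dvdn dvdn_divisors // !inE => /or3P[] /eqP->. Qed.

Lemma order3I (gT : finGroupType) (x : gT) : x ^+ 3 == 1 -> x != 1 -> #[x] = 3.
Proof. by rewrite -order_dvdn dvdn_divisors // !inE -order_eq1 => /orP[] /eqP->. Qed.

Lemma SU9_facts : U33_facts SU9.
Proof.
have /and3P[/eqP sz /eqP o6 _] := listSU_facts.
have Lp : unitary9 perm9 by vm_compute.
have Lt : unitary9 transv9 by vm_compute.
have La : unitary9 (diag9 i9 one9 (opp9 i9)) by vm_compute.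
have Lb : unitary9 (diag9 one9 i9 (opp9 i9)) by vm_compute.
have gX := gl9X.
have gX1 n A : unitary9 A -> (gl9 A ^+ n == 1) = (iter n (mmul A) mone == mone).
  by move=> LA; have [-> Ln] := gX n A LA; rewrite gl9_eq1.
have ord4 A : unitary9 A -> iter 4 (mmul A) mone == mone -> iter 2 (mmul A) mone != mone ->
    #[gl9 A] = 4.
  by move=> LA; rewrite -(gX1 4 A LA) -(gX1 2 A LA); apply: order4I.
have ord3 A : unitary9 A -> iter 3 (mmul A) mone == mone -> A != mone -> #[gl9 A] = 3.
  by move=> LA; rewrite -(gX1 3 A LA) -(gl9_eq1 LA); apply: order3I.
split.
- rewrite -sz -(count_predT listSU) -(card_SU9_sub predT).
  by apply: eq_card => g; rewrite [RHS]inE andbT.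
- rewrite -o6 card_SU9_sub; apply: eq_in_count => A; rewrite mem_listSU; exact: order6_gl9.
(* The squares are diag(-1, 1, -1) and diag(1, -1, -1). *)
- exists (gl9 (diag9 i9 one9 (opp9 i9))), (gl9 (diag9 one9 i9 (opp9 i9))).
  split; [split; [exact: gl9_SU | exact: gl9_SU | apply/gl9_commute => //; by vm_compute] | | | ].
  + by apply: ord4 => //; vm_compute.
  + by apply: ord4 => //; vm_compute.
  have [-> L1] := gX 2 _ La; have [-> L2] := gX 2 _ Lb.
  by apply/eqP=> /(gl9_inj L1 L2)/eqP; vm_compute.
(* The all-one matrix J commutes with permutation matrices, and (1 + i J) ^+ 3 = 1 because 3 = 0 and
   J ^+ 2 = 0. *)
exists (gl9 perm9), (gl9 transv9).
have o3 : #[gl9 perm9] = 3 by apply: ord3 => //; vm_compute.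
split; [split; [exact: gl9_SU | exact: gl9_SU | apply/gl9_commute => //; by vm_compute] | exact: o3 | | ].
  by apply: ord3; [exact: Lt | vm_compute | vm_compute].
apply/cycleP=> [[n]]; rewrite -(expg_mod_order) o3.
have [-> Ln] := gX (n %% 3)%N perm9 Lp; move/(gl9_inj Lt Ln)/eqP; apply/negP.
by case: (n %% 3)%N (@ltn_pmod n 3 isT) => [|[|[|//]]] _; vm_compute.
Qed.

Lemma U33_facts_U33 : U33_facts U33.
Proof.
have Z1 := center_SU9.
apply: U33_facts_isog SU9_facts; apply: (@quotient_isog _ 'Z(SU9)%G SU9).
  exact: gFnorm.
apply/trivgP; apply: subset_trans (subsetIl _ _) _.
by move/eqP: Z1; rewrite eqEsubset => /andP[].
Qed.

(** * Pseudo U_3(3)-solvable groups *)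

(** A composition series of [M] with [M] put in front is one of [G], and its first factor is
    isomorphic to G / M. *)
Lemma pseudo_maxnormal (gT : finGroupType) (G M : {group gT}) :
    maxnormal M G G -> pseudo_U33_solvable G ->
  pseudo_U33_solvable M /\ (abelian (G / M) \/ G / M \isog U33).
Proof.
move=> maxM psG.
have cons s : comps M s -> comps G (M :: s) by case/andP=> ls ps; apply/and3P.
split=> [s cs X Xs | ].
  by apply: (psG _ (cons s cs)); rewrite inE Xs orbT.
have [s cs] := exists_comps M.
have := psG _ (cons s cs) (section_repr (mkSec G M)); rewrite inE eqxx => /(_ isT).
have isoX := section_reprP (mkSec G M).
case=> [abX | isoU]; first by left; rewrite -(isog_abelian isoX).
by right; apply: isog_trans isoU; rewrite isog_sym.
Qed.

Lemma pseudo_simple (gT : finGroupType) (G : {group gT}) :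
  pseudo_U33_solvable G -> simple G -> abelian G \/ U33_facts G.
Proof.
move=> psG; rewrite simple_maxnormal => max1.
have [_ [ab1 | iso1]] := pseudo_maxnormal max1 psG.
  by left; rewrite (isog_abelian (quotient1_isog G)).
right; apply: U33_facts_isog U33_facts_U33.
by rewrite isog_sym; apply: isog_trans iso1; apply: quotient1_isog.
Qed.

Lemma pseudo_normal (gT : finGroupType) (G N : {group gT}) :
  N <| G -> pseudo_U33_solvable G -> pseudo_U33_solvable N.
Proof.
have [n] := ubnP #|G|; elim: n G => // n IHn G /ltnSE-leGn nsNG psG.
have [/group_inj-> // | neqNG] := eqVneq (N : {set gT}) G.
have [sNG nNG] := andP nsNG.
have [M maxM sNM]: {M : {group gT} | maxnormal M G G & N \subset M}.
  by apply: maxgroup_exists; rewrite properEneq neqNG sNG.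
apply: (IHn M) (proj1 (pseudo_maxnormal maxM psG)).
  exact: leq_trans (proper_card (maxnormal_proper maxM)) leGn.
exact: normalS sNM (maxnormal_sub maxM) nsNG.
Qed.

(** A composition series of the quotient is lifted term by term; the third isomorphism theorem
    identifies its factors with factors of [G]. *)
Lemma pseudo_quotient (gT : finGroupType) (G N : {group gT}) :
  N <| G -> pseudo_U33_solvable G -> pseudo_U33_solvable (G / N)%G.
Proof.
move=> nsNG psG s; elim: s G nsNG psG => [|Mb s IHs] G nsNG psG cs X //.
have /andP[_ /andP[/= maxMb _]] := cs.
have [M defMb sNM nsMG] := inv_quotientN nsNG (maxnormal_normal maxMb).
have nsNM : N <| M := normalS sNM (normal_sub nsMG) nsNG.
have eMb : Mb = (M / N)%G by apply: group_inj.
subst Mb; have isoQ : (G / N) / (M / N) \isog G / M := third_isog sNM nsNG nsMG.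
have maxM : maxnormal M G G.
  by rewrite -quotient_simple // -(isog_simple isoQ) quotient_simple ?quotient_normal.
have [psM facM] := pseudo_maxnormal maxM psG.
rewrite inE => /orP[/eqP-> | Xs]; last exact: (IHs M nsNM psM (comps_cons cs)).
have isoX := section_reprP (mkSec (G / N)%G (M / N)%G).
case: facM => [abM | isoM]; [left | right].
  by rewrite (isog_abelian isoX) /= (isog_abelian isoQ).
exact: isog_trans isoX (isog_trans isoQ isoM).
Qed.

Lemma solvable_pseudo (gT : finGroupType) (G : {group gT}) :
  solvable G -> pseudo_U33_solvable G.
Proof.
move=> solG s; elim: s G solG => [|M s IHs] G solG cs X //.
have /andP[_ /andP[/= maxM _]] := cs.
rewrite inE => /orP[/eqP-> | Xs]; last first.
  apply: (IHs M _ (comps_cons cs)) => //; exact: solvableS (maxnormal_sub maxM) solG.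
left; rewrite (isog_abelian (section_reprP _)) /=.
have simQ : simple (G / M) by rewrite quotient_simple ?(maxnormal_normal maxM).
by apply: cyclic_abelian; apply: prime_cyclic; apply: simple_sol_prime simQ; apply: quotient_sol.
Qed.

Lemma pseudo_section (gT : finGroupType) (G : {group gT}) :
    pseudo_U33_solvable G -> ~~ solvable G ->
  exists A B : {group gT}, [/\ A \subset G, B <| A & U33_facts (A / B)%G].
Proof.
have [n] := ubnP #|G|; elim: n G => // n IHn G /ltnSE-leGn psG nsolG.
have ntG : G != 1%G by apply: contraNneq nsolG => ->; apply: solvable1.
have [M maxM] := ex_maxnormal_ntrivg ntG.
have [psM facM] := pseudo_maxnormal maxM psG.
have nsMG := maxnormal_normal maxM.
case: facM => [abM | isoM]; last first.
  exists G, M; split=> //; apply: U33_facts_isog U33_facts_U33.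
  by rewrite isog_sym.
have [|||A [B [sAM nsBA fAB]]] := IHn M.
- exact: leq_trans (proper_card (maxnormal_proper maxM)) leGn.
- by [].
- by apply: contra nsolG => solM; rewrite (series_sol nsMG) solM abelian_sol.
by exists A, B; split=> //; apply: subset_trans sAM (normal_sub nsMG).
Qed.

Lemma U33_has_order6 (gT : finGroupType) (T : {group gT}) : U33_facts T -> has_order T 6.
Proof.
case=> _ o6 _ _; have: 0 < #|[set x in T | #[x] == 6]| by rewrite o6.
by case/card_gt0P=> x; rewrite inE => /andP[Tx /eqP ox]; apply/has_orderP; exists x.
Qed.

Lemma pseudo_order6 (gT : finGroupType) (G : {group gT}) :
  pseudo_U33_solvable G -> ~~ solvable G -> has_order G 6.
Proof.
move=> psG /(pseudo_section psG)[A [B [sAG _ /U33_has_order6]]].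
by move/has_order_quotient; apply: has_orderS.
Qed.

(** * Groups of rank 1 and the fixed points of sections U_3(3) *)

Lemma rank1_cyclic_subgroup (gT : finGroupType) (p : nat) (P : {group gT}) :
    p.-group P -> 'r_p(P) <= 1 ->
  cyclic P \/ p = 2 /\ exists2 X : {group gT}, X \subset P & cyclic X /\ #|P : X| = 2.
Proof.
move=> pP r1.
have cyc1 (X : {group gT}) : X \subset P -> abelian X -> cyclic X.
  move=> sXP abX; rewrite abelian_rank1_cyclic // (rank_pgroup (pgroupS sXP pP)).
  exact: leq_trans (p_rankS p sXP) r1.
have [abP | nabP] := boolP (abelian P); first by left; apply: cyc1.
right; have [X maxX]: {X | [max X | X <| P & abelian X]}.
  by apply: ex_maxgroup; exists 1%G; rewrite normal1 abelian1.
have [nsXP abX] := andP (maxgroupp maxX); have sXP := normal_sub nsXP.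
have cycX := cyc1 X sXP abX.
have scnX := max_SCN pP maxX.
(* A maximal normal abelian subgroup that is cyclic has index 2 in a 2-group, unless there is an
   elementary abelian subgroup of rank 2. *)
have [[-> iX _] | [M [_ _ _ EM _]]] := cyclic_SCN pP scnX nabP cycX.
  by split=> //; exists X.
have: 1 < 'r_p(P) by apply/p_rank_geP; exists 'Ohm_1(M)%G.
by rewrite ltnNge r1.
Qed.

(** Modulo a cyclic subgroup of index 2 all squares vanish, so 'Mho^1 lies in that subgroup. Unlike
    the rank, cyclicity of 'Mho^1 passes to quotients. *)
Lemma rank1_Mho_cyclic (gT : finGroupType) (P : {group gT}) :
  2.-group P -> 'r_2(P) <= 1 -> cyclic 'Mho^1(P).
Proof.
move=> pP r1; have [cycP | [_ [X sXP [cycX iX]]]] := rank1_cyclic_subgroup pP r1.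
  exact: cyclicS (Mho_sub 1 P) cycP.
apply: cyclicS cycX; rewrite /= (MhoE 1 pP) gen_subG; apply/subsetP=> _ /imsetP[x Px ->].
have nsXP : X <| P by apply: index2_normal.
rewrite expn1 coset_idr ?groupX ?(subsetP (normal_norm nsXP)) //.
rewrite morphX ?(subsetP (normal_norm nsXP)) //; apply/eqP.
by rewrite -order_dvdn -iX -card_quotient ?normal_norm // order_dvdG ?mem_quotient.
Qed.

(* A free action forces the Sylow 2-subgroups of G to have cyclic sections
   'Mho^1 and the Sylow 3-subgroups to be cyclic, contrary to U33_facts. *)
Lemma section_has_order (gT : finGroupType) (G V A B : {group gT}) (t r : nat) :
    V <| G -> V :!=: 1 -> r.-group V -> A \subset G -> B <| A -> U33_facts (A / B)%G ->
    t \in [:: 2; 3] -> t != r ->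
  has_order G (t * r).
Proof.
move=> nsVG ntV rV sAG nsBA [_ _ fact2 fact3] t23 ntr; apply: contraT => no_tr.
have t_pr : prime t by move: t23; rewrite !inE => /orP[] /eqP->.
have [P sylP] := Sylow_exists t A; have [sPA tP _] := and3P sylP.
have sPG := subset_trans sPA sAG.
have r1 : 'r_t(P) <= 1.
  apply: (p_rank1_of_free t_pr ntr sPG (normal_sub nsVG) _ rV ntV tP no_tr).
  exact: subset_trans sPG (normal_norm nsVG).
have nBP : P \subset 'N(B) := subset_trans sPA (normal_norm nsBA).
have sylPB : t.-Sylow(A / B) (P / B) := quotient_pHall nBP sylP.
have tPB : t.-group (P / B) := pHall_pgroup sylPB.
(* Commuting t-elements generate a t-group, which Sylow's theorem moves into P / B. *)
have conjab a b : a \in A / B -> b \in A / B -> commute a b -> t.-elt a -> t.-elt b ->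
    exists x, a ^ x \in P / B /\ b ^ x \in P / B.
  move=> Aa Ab cab ta tb.
  have sE : <[a]> <*> <[b]> \subset A / B by rewrite join_subG !cycle_subG Aa.
  have tE : t.-group (<[a]> <*> <[b]>).
    rewrite norm_joinEr ?pgroupM; first exact/andP.
    by rewrite cents_norm // cent_cycle cycle_subG; apply/cent1P.
  have [x _ sub] := Sylow_Jsub sylPB sE tE.
  exists x; split; apply: (subsetP sub); rewrite memJ_conjg mem_gen // inE cycle_id ?orbT //.
move: t23; rewrite !inE => /orP[] /eqP def_t; subst t.
  have [a [b [[Aa Ab cab] oa ob nab]]] := fact2.
  have [||x [Pa Pb]] := conjab a b Aa Ab cab; rewrite ?/(p_elt _ _) ?oa ?ob //.
  have cycM : cyclic 'Mho^1(P / B).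
    by rewrite /quotient -morphim_Mho //; apply: morphim_cyclic; apply: rank1_Mho_cyclic.
  have Mho2 y : y \in P / B -> y ^+ 2 \in 'Mho^1(P / B).
    by move=> Py; rewrite -[2]/(2 ^ 1)%N Mho_p_elt // (mem_p_elt tPB).
  have o2 y : #[y] = 4 -> #[y ^+ 2] = 2 by move=> oy; rewrite orderXdiv oy.
  have ox2 : #[(a ^ x) ^+ 2] = 2 by apply: o2; rewrite orderJ.
  have oy2 : #[(b ^ x) ^+ 2] = 2 by apply: o2; rewrite orderJ.
  (* A cyclic group has at most one subgroup of order 2, and that subgroup has only one involution;
     so the squares of a and b coincide. *)
  have: <[(a ^ x) ^+ 2]> :==: <[(b ^ x) ^+ 2]>.
    by rewrite (eq_subG_cyclic cycM) ?cycle_subG ?Mho2 // -!orderE ox2 oy2.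
  move=> /eqP eqab; have: (a ^ x) ^+ 2 \in <[(b ^ x) ^+ 2]> by rewrite -eqab cycle_id.
  case/cycleP=> i; rewrite -(expg_mod_order) oy2.
  case: (i %% 2)%N (@ltn_pmod i 2 isT) => [|[|//]] _ => [a2 | ].
    by move: ox2; rewrite a2 expg0 order1.
  by rewrite expg1 -!conjXg => /conjg_inj eq2; rewrite eq2 eqxx in nab.
have [a [b [[Aa Ab cab] oa ob nab]]] := fact3.
have [||x [Pa Pb]] := conjab a b Aa Ab cab; rewrite ?/(p_elt _ _) ?oa ?ob //.
have cycP : cyclic P by rewrite (odd_pgroup_rank1_cyclic tP) // (odd_pgroup_odd _ tP).
have cycPB : cyclic (P / B) := quotient_cyclic _ cycP.
have: <[a ^ x]> :==: <[b ^ x]>.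
  by rewrite (eq_subG_cyclic cycPB) ?cycle_subG // -!orderE !orderJ oa ob.
move/eqP=> eqab; case/negP: nab; rewrite -(memJ_conjg _ x) -cycleJ eqab cycle_id //.
Qed.

Lemma order_dvd6 (gT : finGroupType) (x : gT) (t : nat) :
  #[x] = 6 -> t \in [:: 2; 3] -> #[x ^+ (6 %/ t)] = t.
Proof.
by move=> ox; rewrite !inE => /orP[] /eqP->; rewrite orderXdiv ox.
Qed.

Lemma prime23 t : t \in [:: 2; 3] -> prime t.
Proof. by rewrite !inE => /orP[] /eqP->. Qed.

(** Conjugation by x shifts the factors cyclically, and commutation lets the factor that leaves at
    one end come back at the other. *)
Lemma orbit_product (gT : finGroupType) (x y : gT) (r t : nat) :
    (forall i j, i < r -> j < r -> commute (y ^ (x ^+ i)) (y ^ (x ^+ j))) ->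
    #[x] = r -> y ^+ t = 1 ->
  let z := \prod_(i < r) y ^ (x ^+ i) in z ^ x = z /\ z ^+ t = 1.
Proof.
move=> comm ox yt /=; set f := fun i => y ^ (x ^+ i).
have r_gt0 : 0 < r by rewrite -ox order_gt0.
have prodC n j : n <= r -> j < r -> commute (\prod_(i < n) f i) (f j).
  move=> le_nr lt_jr; elim: n le_nr => [|n IHn] le_nr.
    by rewrite big_ord0; apply/commute_sym/commute1.
  rewrite big_ord_recr /=; apply/commute_sym/commuteM; apply/commute_sym.
    exact: IHn (ltnW le_nr).
  exact: comm.
split; last first.
  suff pX n : n <= r -> (\prod_(i < n) f i) ^+ t = 1 by exact: pX.
  elim: n => [|n IHn] le_nr; first by rewrite big_ord0 expg1n.
  rewrite big_ord_recr /= expgMn; last exact: prodC (ltnW le_nr) le_nr.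
  by rewrite IHn ?(ltnW le_nr) // mul1g -conjXg yt conj1g.
have zx : (\prod_(i < r) f i) ^ x = \prod_(i < r) f i.+1.
  rewrite (big_morph (conjg^~ x) (fun a b => conjMg a b x) (conj1g x)).
  by apply: eq_bigr => i _; rewrite /f expgSr conjgM.
have f0 : f 0 = y by rewrite /f expg0 conjg1.
have fr : f r = y by rewrite /f -ox expg_order conjg1.
have eq2 : y * \prod_(i < r) f i.+1 = (\prod_(i < r) f i) * y.
  rewrite -{1}f0 -(big_ord_recl r (fun i : 'I_r.+1 => f i)) -[in RHS]fr.
  by rewrite -(big_ord_recr r (fun i : 'I_r.+1 => f i)).
apply: (mulgI y); rewrite zx eq2; have := prodC r 0 (leqnn r) r_gt0.
by rewrite f0.
Qed.

(** If x normalizes [S], it permutes the 504 elements of order 6 and fixes one, since #[x] does not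
    divide 504; a power of that element has order t. Otherwise the conjugates of [S] under the
    powers of x are distinct simple normal subgroups of [N], so they commute pairwise, and x fixes
    the product of the conjugates of an element of order t. *)
Lemma simple_component_has_order (gT : finGroupType) (G N S : {group gT}) (x : gT) (t : nat) :
    N <| G -> S <| N -> simple S -> ~~ abelian S -> U33_facts S ->
    x \in G -> prime #[x] -> coprime #[x] #|S| -> t \in [:: 2; 3] ->
  has_order G (t * #[x]).
Proof.
move=> nsNG nsSN simS nabS uS Gx x_pr coxS t23; set r := #[x] in x_pr coxS *.
have t_pr := prime23 t23; have [oS o6 _ _] := uS.
have sSG : S \subset G := subset_trans (normal_sub nsSN) (normal_sub nsNG).
have co_rt : coprime t r.
  rewrite coprime_sym; apply: coprime_dvdr coxS; rewrite oS.
  by move: t23; rewrite !inE => /orP[] /eqP->.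
suff [z [Gz oz czx]] : exists z, [/\ z \in G, #[z] = t & commute z x].
  by rewrite -oz; apply: has_order_mul; rewrite ?oz.
have mem6 (z : gT) : z \in S -> #[z] = 6 -> exists y, [/\ y \in S, #[y] = t & y \in <[z]>].
  move=> Sz oz; exists (z ^+ (6 %/ t)); rewrite groupX // mem_cycle.
  by split=> //; apply: order_dvd6.
have [nSx | nnSx] := boolP (x \in 'N(S)).
  pose S6 := [set z in S | #[z] == 6].
  have actS6 : [acts <[x]>, on S6 | 'J].
    rewrite astabsJ cycle_subG inE; apply/subsetP=> _ /imsetP[z S6z ->].
    by move: S6z; rewrite !inE memJ_norm // orderJ.
  have rx : r.-group <[x]> by rewrite /pgroup -orderE pnat_id.
  have := pgroup_fix_mod rx actS6; rewrite o6 afixJ => fixmod.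
  have [z /setIP[]] : exists z, z \in S6 :&: 'C(<[x]>).
    apply/set0Pn; apply: contraTneq (x_pr) => fix0; move: fixmod.
    rewrite fix0 cards0 mod0n => /eqP; rewrite -[_ == _]/(r %| 504) => r504.
    move: coxS; rewrite prime_coprime // => /negP[]; apply: dvdn_trans r504 _.
    by rewrite oS.
  rewrite inE cent_cycle => /andP[Sz /eqP oz] /cent1P cxz.
  have [y [Sy oy /cycleP[i def_y]]] := mem6 z Sz oz.
  exists y; rewrite (subsetP sSG) // def_y -{1}def_y oy; split=> //.
  exact/commute_sym/commuteX.
have pwN i : ~~ (r %| i) -> x ^+ i \notin 'N(S).
  move=> n_ri; apply: contra nnSx => nSxi.
  have co_ri : coprime r i by rewrite prime_coprime.
  have /eqP defx : generator <[x]> (x ^+ i) by rewrite generator_coprime.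
  have: <[x ^+ i]> \subset 'N(S) by rewrite cycle_subG.
  by rewrite -defx cycle_subG.
have [z6 S6z] : exists z, z \in [set z in S | #[z] == 6] by apply/card_gt0P; rewrite o6.
move: S6z; rewrite inE => /andP[Sz6 /eqP oz6].
have [y [Sy oy _]] := mem6 z6 Sz6 oz6.
pose Sc i := (S :^ (x ^+ i))%G.
have nsSc i : Sc i <| N.
  by rewrite -(normsP (normal_norm nsNG) (x ^+ i)) ?groupX // normalJ.
have cSc i j : i < r -> j < r -> i != j -> Sc i \subset 'C(Sc j).
  move=> lt_ir lt_jr; wlog lt_ij : i j lt_ir lt_jr / i < j.
    move=> IH; rewrite neq_ltn => /orP[] lt_ij; first by apply: IH => //; rewrite ltn_eqF.
    by rewrite centsC; apply: IH => //; rewrite ltn_eqF.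
  move=> _; have [sA nA] := andP (nsSc i); have [sB nB] := andP (nsSc j).
  have simA : simple (Sc i) by rewrite -(isog_simple (conj_isog S (x ^+ i))).
  have nsAB : Sc i :&: Sc j <| Sc i.
    by rewrite /normal subsetIl normsI ?normG // (subset_trans sA).
  have [_ /(_ (Sc i :&: Sc j)%G nsAB)[AB1 | /setIidPl sAB]] := simpleP _ simA.
    apply/commG1P/trivgP; rewrite -AB1 subsetI commg_subl commg_subr.
    by rewrite (subset_trans sA nB) (subset_trans sB nA).
  have eqAB : S :^ (x ^+ i) = S :^ (x ^+ j).
    by apply/eqP; rewrite eqEcard sAB !cardJg leqnn.
  have n_rij : ~~ (r %| j - i).
    rewrite gtnNdvd ?subn_gt0 //; exact: leq_ltn_trans (leq_subr _ _) lt_jr.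
  case/negP: (pwN _ n_rij); apply/normP; apply: (@conjsg_inj _ (x ^+ i)).
  by rewrite -conjsgM -expgD subnK // ltnW.
have yS i : y ^ (x ^+ i) \in Sc i by rewrite memJ_conjg.
have comm i j : i < r -> j < r -> commute (y ^ (x ^+ i)) (y ^ (x ^+ j)).
  move=> lt_ir lt_jr; have [-> // | nij] := eqVneq i j.
  exact: (centsP (cSc i j lt_ir lt_jr nij)).
have yt : y ^+ t = 1 by rewrite -oy expg_order.
have [] := orbit_product comm (erefl r) yt; set z := \prod_(i < r) _ => zx zt.
have r_gt0 := prime_gt0 x_pr.
exists z; split; last by apply/commgP/conjg_fixP.
  by apply: group_prod => i _; rewrite groupJ ?groupX // (subsetP sSG).
have [_ tP] := primeP t_pr.
have ntz : z != 1.
  (* If the product were 1, the inverse of y would be a product of elements of the other conjugates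
     of [S], all of which centralize [S]. *)
  apply/eqP=> z1; have Zy : y \in 'Z(S).
    rewrite inE Sy /= -groupV; move: z1.
    rewrite /z -(big_mkord xpredT (fun i => y ^ (x ^+ i))) big_ltn // conjg1.
    move/eqP; rewrite -eq_invg_mul => /eqP->; rewrite big_seq; apply: group_prod => i.
    rewrite mem_index_iota => /andP[i_gt0 lt_ir].
    apply: (subsetP (_ : Sc i \subset 'C(S))) => //.
    have := cSc i 0 lt_ir r_gt0; rewrite /= conjsg1; apply; by rewrite gtn_eqF.
  have [_ /(_ 'Z(S)%G (center_normal S))[Z1 | ZS]] := simpleP _ simS.
    by move: Zy; rewrite Z1 => /set1P y1; move: t_pr; rewrite -oy y1 order1.
  by case/negP: nabS; rewrite -ZS center_abelian.
have /tP/orP[/eqP z1 | /eqP//] : #[z] %| t by rewrite order_dvdn zt.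
by case/eqP: ntz; apply/eqP; rewrite -order_eq1 z1.
Qed.

Lemma dvd_order_U33 t : prime t -> t %| 2 ^ 5 * 3 ^ 3 * 7 -> t \in [:: 2; 3; 7].
Proof.
move=> t_pr; rewrite (Euclid_dvdM _ _ t_pr) (Euclid_dvdM _ _ t_pr) !(Euclid_dvdX _ _ t_pr).
by rewrite !dvdn_prime2 // !andbT !inE -orbA.
Qed.

(** A minimal normal subgroup is a direct product of isomorphic simple groups. Abelian factors would
    make 'F(N) a nontrivial characteristic subgroup, hence all of [N]; so the factors are copies of
    U_3(3). *)
Lemma pseudo_minnormal (gT : finGroupType) (G N : {group gT}) :
    pseudo_U33_solvable G -> minnormal N G -> N \subset G -> ~~ solvable N ->
    [/\ exists S : {group gT}, [/\ S <| N, simple S, ~~ abelian S & U33_facts S]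
     & forall t, prime t -> t %| #|N| -> t \in [:: 2; 3; 7]].
Proof.
move=> psG minN sNG nsolN; have [/andP[ntN nNG] _] := mingroupP minN.
have nsNG : N <| G by apply/andP.
have charN := minnormal_charsimple minN.
have [H [sHN simH [I sIA defN]]] := charsimple_dprod charN.
have [f If] : exists f, f \in I.
  apply/set0Pn; apply: contraNneq ntN => I0.
  by rewrite -defN I0 big_set0.
have imgrp g : g \in I -> exists2 K : {group gT}, g @: H = K & H \isog K.
  move=> Ig; have Ag := subsetP sIA g Ig.
  exists (autm Ag @* H)%G; first by rewrite /= morphimEsub.
  by apply: sub_isog => //; apply: injm_autm.
have [S defS isoHS] := imgrp f If.
have nsSN : S <| N.
  by rewrite -defS; move: defN; rewrite (bigD1 f) //= => /dprod_normal2[].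
have simS : simple S by rewrite -(isog_simple isoHS).
have psS := pseudo_normal nsSN (pseudo_normal nsNG psG).
have nabS : ~~ abelian S.
  apply: contra nsolN => abS; have [ntS _] := simpleP _ simS.
  have sSF : S \subset 'F(N) by rewrite Fitting_max ?abelian_nil.
  have [_ minN'] := charsimpleP _ charN.
  have <- : 'F(N) = N.
    apply: minN'; last exact: Fitting_char.
    by apply: contra ntS => /eqP F1; rewrite -subG1 -F1.
  exact: nilpotent_sol (Fitting_nil N).
have uS : U33_facts S by case: (pseudo_simple psS simS) => // abS; rewrite abS in nabS.
split; first by exists S.
move=> t t_pr; rewrite -(bigdprod_card defN).
elim/big_rec: _ => [|g n Ig IHn]; first by rewrite dvdn1 => /eqP t1; rewrite t1 in t_pr.
rewrite Euclid_dvdM // => /orP[] //.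
have [K -> isoK] := imgrp g Ig; rewrite -(card_isog isoK) (card_isog isoHS).
by have [oS _ _ _] := uS; rewrite oS; apply: dvd_order_U33.
Qed.

(** Induction through a minimal normal subgroup [N]. If [N] is not solvable, an element of order r
    acts on its simple factors; if r divides #|G / N|, the quotient suffices; otherwise [N] is an
    r-group on which the Sylow t-subgroups of a section U_3(3) cannot act freely. *)
Lemma pseudo_has_order (gT : finGroupType) (G : {group gT}) (r t : nat) :
    pseudo_U33_solvable G -> ~~ solvable G -> prime r -> r %| #|G| ->
    r \notin [:: 2; 3; 7] -> t \in [:: 2; 3] ->
  has_order G (t * r).
Proof.
move=> psG nsolG r_pr r_G r237 t23.
have ntr : t != r.
  by move: r237 t23; rewrite !inE !negb_or => /and3P[? ? _] /orP[] /eqP->; rewrite eq_sym.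
move: psG nsolG r_G; have [n] := ubnP #|G|.
elim: n gT G => // n IHn gT G /ltnSE-leGn psG nsolG r_G.
have ntG : G :!=: 1 by apply: contraNneq nsolG => /group_inj->; apply: solvable1.
have [N minN sNG] := minnormal_exists ntG (normG G).
have [/andP[ntN nNG] _] := mingroupP minN; have nsNG : N <| G by apply/andP.
have [solN | nsolN] := boolP (solvable N); last first.
  have [[S [nsSN simS nabS uS]] _] := pseudo_minnormal psG minN sNG nsolN.
  have [x Gx ox] := Cauchy r_pr r_G; rewrite -ox.
  have [oS _ _ _] := uS.
  apply: simple_component_has_order nsNG nsSN simS nabS uS Gx _ _ t23; rewrite ox //.
  rewrite oS prime_coprime //.
  by apply: contra r237; apply: dvd_order_U33.
have nsolGN : ~~ solvable (G / N) by rewrite (series_sol nsNG) solN in nsolG.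
have [r_GN | n_r_GN] := boolP (r %| #|G / N|).
  apply: (@has_order_quotient _ G N); apply: IHn => //.
    exact: leq_trans (ltn_quotient ntN sNG) leGn.
  exact: pseudo_quotient.
have [_ _ /is_abelemP[p p_pr abN]] := minnormal_solvable minN (subxx N) solN.
have def_r : r = p.
  apply/eqP; rewrite -dvdn_prime2 //; move: r_G.
  rewrite -(Lagrange sNG) -card_quotient // Euclid_dvdM // (negPf n_r_GN) orbF.
  by rewrite (card_pgroup (abelem_pgroup abN)) (Euclid_dvdX _ _ r_pr) => /andP[].
subst p; have [A [B [sAG nsBA factAB]]] := pseudo_section psG nsolG.
exact: section_has_order nsNG ntN (abelem_pgroup abN) sAG nsBA factAB t23 ntr.
Qed.

(* The Frattini argument makes the Sylow subgroups of 'Phi(G) normal. *)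
Lemma Phi_nil (gT : finGroupType) (G : {group gT}) : nilpotent 'Phi(G).
Proof.
suff sPF : 'Phi(G) \subset 'F('Phi(G)) by apply: nilpotentS sPF (Fitting_nil _).
suff : #|'Phi(G)| %| #|'F('Phi(G))|.
  move/dvdn_leq=> /(_ (cardG_gt0 _)) leFP.
  by have /eqP-> : 'F('Phi(G)) == 'Phi(G) by rewrite eqEcard Fitting_sub.
apply/dvdn_partP=> // p _; have [P sylP] := Sylow_exists p 'Phi(G).
rewrite -(card_Hall sylP) cardSg // Fitting_max ?(pgroup_nil (pHall_pgroup sylP)) //.
have sPhiP := pHall_sub sylP.
have defG : 'Phi(G) <*> 'N_G(P) = G.
  have /= := Frattini_arg (Phi_normal G) sylP; move=> defG.
  apply/eqP; rewrite eqEsubset join_subG Phi_sub subsetIl /= -{1}defG.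
  by rewrite mul_subG ?joing_subl ?joing_subr.
have /= := Phi_nongen defG; rewrite genGid => /setIidPl nPG.
by rewrite /normal sPhiP (subset_trans (Phi_sub G)).
Qed.

(* A minimal supplement L of a normal subgroup K meets it inside 'Phi(L). *)
Lemma solvable_supplement (gT : finGroupType) (G K : {group gT}) :
    K <| G -> solvable (G / K) ->
  exists L : {group gT}, [/\ L \subset G, K * L = G & solvable L].
Proof.
move=> nsKG solGK; have [sKG nKG] := andP nsKG.
have [L minL sLG]: {L : {group gT} | [min L of L | (L \subset G) && (K * L == G)] & L \subset G}.
  by apply: mingroup_exists; rewrite subxx mulSGid ?eqxx.
have [/andP[_ /eqP defG] minL'] := mingroupP minL.
exists L; split=> //; have nKL : L \subset 'N(K) := subset_trans sLG nKG.
have nsKL : K :&: L <| L by rewrite /normal subsetIr normsI ?normG.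
have sPhi : K :&: L \subset 'Phi(L).
  apply/bigcapsP=> M /predU1P[-> | maxM]; first exact: subsetIr.
  have [/andP[sML _] maxM'] := maxgroupP maxM.
  apply: contraT => not_sub.
  have nKM : M \subset L by exact: proper_sub (maxgroupp maxM).
  have defL : (K :&: L) <*> M = L.
    apply/eqP; rewrite eqEproper join_subG subsetIr nKM /=.
    apply/negP=> pr; have := maxM' _ pr (joing_subr _ _) => eqM.
    by case/negP: not_sub; rewrite -eqM joing_subl.
  have KM : K * M = G.
    rewrite -defG -{1}defL norm_joinEr; last by rewrite (subset_trans nKM) // normal_norm.
    by rewrite mulgA (mulGSid (subsetIl K L)).
  have eqML : M :=: L by apply: minL' => //; rewrite (subset_trans nKM sLG) KM eqxx.
  by have := maxgroupp maxM; rewrite eqML properxx.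
rewrite (series_sol nsKL) (solvableS sPhi (nilpotent_sol (Phi_nil L))) /=.
have /isog_sol-> : L / (K :&: L) \isog L / K by apply: second_isog.
by apply: solvableS solGK; apply: quotientS.
Qed.

(** If the minimal normal subgroup [N] is not solvable, 7 is the only prime other than 2 and 3 that
    can divide its order. With [H] the preimage of the solvable subgroup of G / N and [P] a Sylow
    7-subgroup of [N], the normalizer 'N_H(P) covers H / N. A solvable supplement [L] of 'N_N(P) in
    it accounts for the primes of G / N, and [P] for 7. *)
Lemma pseudo_solvable_subgroup (gT : finGroupType) (G : {group gT}) :
    pseudo_U33_solvable G ->
  exists H : {group gT}, [/\ H \subset G, solvable H &
    forall t, prime t -> t %| #|G| -> t \notin [:: 2; 3] -> t %| #|H|].
Proof.
have [n] := ubnP #|G|; elim: n gT G => // n IHn gT G /ltnSE-leGn psG.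
have [/group_inj-> | ntG] := eqVneq (G : {set gT}) 1.
  by exists 1%G; split; rewrite ?solvable1.
have [N minN sNG] := minnormal_exists ntG (normG G).
have [/andP[ntN nNG] _] := mingroupP minN; have nsNG : N <| G by apply/andP.
have [||Hb [sHbG solHb piHb]] := IHn _ (G / N)%G.
- exact: leq_trans (ltn_quotient ntN sNG) leGn.
- exact: pseudo_quotient.
have [H defHb sNH sHG] := inv_quotientS nsNG sHbG.
have nsNH : N <| H := normalS sNH sHG nsNG.
have solHN : solvable (H / N) by rewrite -defHb.
have oG t : prime t -> t %| #|G| -> (t %| #|G / N|) || (t %| #|N|).
  by move=> t_pr; rewrite -(Lagrange sNG) -card_quotient // Euclid_dvdM // orbC.
have [solN | nsolN] := boolP (solvable N).
  exists H; split=> // [|t t_pr t_G t23]; first by rewrite (series_sol nsNH) solN.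
  have /orP[t_GN | t_N] := oG t t_pr t_G; last exact: dvdn_trans t_N (cardSg sNH).
  apply: dvdn_trans (dvdn_quotient H N); rewrite -defHb; exact: piHb.
have [_ piN] := pseudo_minnormal psG minN sNG nsolN.
have [P sylP] := Sylow_exists 7 N; have [sPN p7 _] := and3P sylP.
have defH : N * 'N_H(P) = H := Frattini_arg nsNH sylP.
pose K := ('N_N(P))%G.
have nsKN : K <| 'N_H(P).
  rewrite /normal setSI //= normsI ?normsI ?normG //.
    by rewrite subIset // normal_norm.
  by rewrite subIset // normG orbT.
have solNK : solvable ('N_H(P) / K).
  have defK : (K : {set gT}) = N :&: 'N_H(P).
    by rewrite setIA (setIidPl sNH).
  have /isog_sol-> : 'N_H(P) / K \isog 'N_H(P) / N.
    by rewrite defK; apply: second_isog; rewrite subIset // normal_norm.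
  by apply: solvableS solHN; apply: quotientS; apply: subsetIl.
have [L [sLH defKL solL]] := solvable_supplement nsKN solNK.
have sLH' : L \subset H := subset_trans sLH (subsetIl _ _).
have nPL : L \subset 'N(P) := subset_trans sLH (subsetIr _ _).
have NL : N * L = H by rewrite -defH -defKL mulgA (mulGSid (subsetIl N _)).
exists (P <*> L)%G; split.
- by rewrite join_subG (subset_trans sPN sNG) (subset_trans sLH' sHG).
- have nsP : P <| P <*> L by rewrite normalYl.
  rewrite (series_sol nsP) (nilpotent_sol (pgroup_nil p7)) quotientYidl //.
  exact: quotient_sol.
move=> t t_pr t_G t23; have [t_GN | n_t_GN] := boolP (t %| #|G / N|).
  have: t %| #|L / N|.
    by rewrite -quotientMidl NL -defHb; apply: piHb.
  move/dvdn_trans; apply; apply: dvdn_trans (dvdn_quotient L N) _.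
  by rewrite cardSg ?joing_subr.
have := oG t t_pr t_G; rewrite (negPf n_t_GN) /= => t_N.
have t7 : t = 7.
  by have := piN t t_pr t_N; move: t23; rewrite !inE !negb_or => /andP[/negPf-> /negPf->] /eqP.
by rewrite (dvdn_trans _ (cardSg (joing_subl P L))) // (Hall_dvd sylP) // t7.
Qed.

Theorem pseudo_coloring (gT : finGroupType) (G : {group gT}) :
    pseudo_U33_solvable G ->
  (exists c : nat -> 'I_3, forall p q, prime p -> prime q -> p != q ->
    p %| #|G| -> q %| #|G| -> ~~ has_order G (p * q) -> c p != c q) /\
  (forall p q r, prime p -> prime q -> prime r -> p != q -> q != r -> p != r ->
    p %| #|G| -> q %| #|G| -> r %| #|G| ->
    [|| has_order G (p * q), has_order G (q * r) | has_order G (p * r)]).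
Proof.
move=> psG; have [solG | nsolG] := boolP (solvable G).
  by split=> [|p q r]; [apply: solvable_coloring | apply: lucido].
have o6 := pseudo_order6 psG nsolG.
have [H [sHG solH piH]] := pseudo_solvable_subgroup psG.
have no7 p q : prime p -> prime q -> p != q -> q %| #|G| -> ~~ has_order G (p * q) ->
    p \in [:: 2; 3] -> q = 7.
  move=> p_pr q_pr npq q_G no_pq p23; apply/eqP; apply: contraR no_pq => q_neq7.
  have [q23 | nq23] := boolP (q \in [:: 2; 3]).
    by move: p23 q23 npq; rewrite !inE => /orP[]/eqP-> /orP[]/eqP->.
  apply: pseudo_has_order => //; move: nq23; rewrite !inE !negb_or.
  by case/andP=> -> ->.
have no_sym p q : has_order G (p * q) = has_order G (q * p) by rewrite mulnC.
split.
  have [c cP] := solvable_coloring solH.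
  (* One color serves both 2 and 3: they are adjacent, and each is non-adjacent to at most 7. *)
  have [d ncd] : exists d : 'I_3, d != c 7.
    by case: (c 7) => [[|m] lt_m]; [exists (inord 1) | exists ord0]; rewrite -val_eqE /= ?inordK.
  exists (fun p => if p \in [:: 2; 3] then d else c p) => p q p_pr q_pr npq p_G q_G no_pq.
  have [p23 | np23] := ifPn.
    by have -> := no7 p q p_pr q_pr npq q_G no_pq p23.
  have [q23 | nq23] := ifPn.
    rewrite eq_sym in npq; rewrite no_sym in no_pq; rewrite eq_sym.
    by have -> := no7 q p q_pr p_pr npq p_G no_pq q23.
  apply: cP; rewrite ?piH //; apply: contra no_pq; exact: has_orderS.
move=> p q r p_pr q_pr r_pr npq nqr npr p_G q_G r_G.
have inH : p \notin [:: 2; 3] -> q \notin [:: 2; 3] -> r \notin [:: 2; 3] ->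
    [|| has_order G (p * q), has_order G (q * r) | has_order G (p * r)].
  move=> np nq nr; have := lucido solH p_pr q_pr r_pr npq nqr npr.
  move=> /(_ (piH p p_pr p_G np) (piH q q_pr q_G nq) (piH r r_pr r_G nr)).
  by case/or3P=> /(has_orderS sHG)->; rewrite ?orbT.
(* A triangle of the complement through 2 or 3 would have its other two vertices both equal to 7. *)
apply: contraT; rewrite !negb_or => /and3P[no_pq no_qr no_pr].
have [p23 | np] := boolP (p \in [:: 2; 3]).
  have eq := no7 p q p_pr q_pr npq q_G no_pq p23.
  have er := no7 p r p_pr r_pr npr r_G no_pr p23.
  by rewrite eq er eqxx in nqr.
have [q23 | nq] := boolP (q \in [:: 2; 3]).
  rewrite eq_sym in npq; rewrite no_sym in no_pq.
  have ep := no7 q p q_pr p_pr npq p_G no_pq q23.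
  have er := no7 q r q_pr r_pr nqr r_G no_qr q23.
  by rewrite ep er eqxx in npr.
have [r23 | nr] := boolP (r \in [:: 2; 3]).
  rewrite eq_sym in npr; rewrite eq_sym in nqr; rewrite no_sym in no_pr; rewrite no_sym in no_qr.
  have ep := no7 r p r_pr p_pr npr p_G no_pr r23.
  have eq := no7 r q r_pr q_pr nqr q_G no_qr r23.
  by rewrite ep eq eqxx in npq.
by have := inH np nq nr; rewrite (negPf no_pq) (negPf no_qr) (negPf no_pr).
Qed.

(** * Primes congruent to 1 *)

Local Open Scope ring_scope.

(** As 'Phi_n is not constant, it takes each of the values 0, 1 and -1 finitely often: size Q
    distinct multiples of b cannot all be roots of [Q]. *)
Lemma Cyclotomic_large_value (n b : nat) : (0 < n)%N -> (0 < b)%N ->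
  exists2 a : nat, (b %| a)%N & (1 < absz ('Phi_n).[a%:Z])%N.
Proof.
move=> n_gt0 b_gt0; set P := 'Phi_n.
have szP : (1 < size P)%N by rewrite size_Cyclotomic ltnS totient_gt0.
have nP (c : int) : P - c%:P != 0.
  rewrite subr_eq0; apply: contraTneq szP => ->; rewrite size_polyC.
  by case: (c != 0).
pose Q := P * ((P - 1%:P) * (P - (-1)%:P)).
have nzQ : Q != 0 by rewrite !mulf_neq0 // -[P]subr0 -polyC0.
pose rs := [seq (b * k)%N%:Z | k <- iota 0 (size Q)].
have [/allP rootQ | /allPn[_ /mapP[k _ ->] nroot]] := boolP (all (root Q) rs).
  have : (size rs < size Q)%N.
    apply: max_poly_roots => //; first exact/allP.
    rewrite map_inj_uniq ?iota_uniq // => i j [] /eqP.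
    by rewrite eqn_pmul2l // => /eqP.
  by rewrite size_map size_iota ltnn.
exists (b * k)%N; first exact: dvdn_mulr.
move: nroot; rewrite /root !hornerE !mulf_eq0 !subr_eq0.
case: (P.[_]) => [[|[|m]]|[|m]] //.
Qed.

(* A prime divisor p of 'Phi_n.[a] does not divide n if n divides a; then 'X^n - 1
   is separable modulo p, and a has order exactly n modulo p. *)
Lemma prime_1_mod (n B : nat) :
  (0 < n)%N -> exists p, [/\ prime p, (B < p)%N & (n %| p.-1)%N].
Proof.
move=> n_gt0; set P := 'Phi_n.
(* Since p will not divide a, the factor n keeps p from dividing n, and the factor B! makes p exceed
   B. *)
have [|a /dvdnP[m def_a] Pa] := @Cyclotomic_large_value n (n * B`!) n_gt0.
  by rewrite muln_gt0 n_gt0 fact_gt0.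
pose p := pdiv (absz P.[a%:Z]); have p_pr : prime p by apply: pdiv_prime.
have pP : (p %| absz P.[a%:Z])%N := pdiv_dvd _.
pose x : 'F_p := a%:R; pose f := map_poly (intr : int -> 'F_p).
have nat0 k : (k%:R == 0 :> 'F_p) = (p %| k)%N.
  by rewrite (dvdn_pcharf (pchar_Fp p_pr)).
have fE (q : {poly int}) : (f q).[x] = (q.[a%:Z])%:~R.
  by rewrite -[x]/((a%:Z)%:~R : 'F_p) horner_map.
have fP0 : (f P).[x] = 0.
  apply/eqP; rewrite fE; case: (intP P.[a%:Z]) pP => [|k|k] //= pk;
  by rewrite ?rmorphN ?oppr_eq0 ?rmorph0 //= -pmulrn nat0 // -?abszN.
have prodP : 'X^n - 1 = P * \prod_(d <- divisors n | d != n) 'Phi_d.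
  by rewrite -prod_Cyclotomic // (bigD1_seq n) ?divisors_uniq //= -dvdn_divisors.
have fXn k : f ('X^k - 1) = 'X^k - 1.
  by rewrite /f rmorphB rmorphXn /= map_polyX rmorph1.
have fM q1 q2 : f (q1 * q2) = f q1 * f q2 by rewrite /f rmorphM.
have xn1 : x ^+ n = 1.
  have := congr1 (fun q => (f q).[x]) prodP; rewrite fXn.
  rewrite fM hornerM fP0 mul0r hornerD hornerN hornerXn hornerC => /eqP.
  by rewrite subr_eq0 => /eqP.
have nz_x : x != 0.
  by apply: contra_eq_neq xn1 => ->; rewrite expr0n eqn0Ngt n_gt0 eq_sym oner_eq0.
have p_a : ~~ (p %| a)%N by rewrite -nat0.
have p_n : ~~ (p %| n)%N by apply: contra p_a => pn; rewrite def_a dvdn_mull // dvdn_mulr.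
exists p; split=> //.
  rewrite ltnNge; apply: contra p_a => leqB; rewrite def_a dvdn_mull // dvdn_mull //.
  by rewrite dvdn_fact // prime_gt0.
have [d prim_d dv_dn] := prim_order_exists n_gt0 xn1.
have [eq_dn | neq_dn] := eqVneq d n.
  rewrite eq_dn in prim_d; rewrite (prim_order_dvd prim_d).
  have xp : x ^+ p = x by have := expf_card x; rewrite card_Fp.
  have : x * x ^+ p.-1 == x * 1 by rewrite -exprS prednK ?prime_gt0 // xp mulr1.
  by rewrite (inj_eq (mulfI nz_x)).
have d_gt0 : (0 < d)%N := dvdn_gt0 n_gt0 dv_dn.
(* If x had order d < n, it would be a root of both 'Phi_n and 'X^d - 1, hence a double root of 'X^n
   - 1, whose derivative n x ^+ n.-1 is nonzero. *)
have [R defR] : exists R, \prod_(e <- divisors n | e != n) 'Phi_e = ('X^d - 1) * R.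
  rewrite (bigID (dvdn^~ d)) /=; eexists; congr (_ * _); rewrite -prod_Cyclotomic // -big_filter.
  apply: perm_big; apply: uniq_perm; rewrite ?filter_uniq ?divisors_uniq // => e.
  rewrite mem_filter -!dvdn_divisors //; case: (boolP (e %| d)%N) => [ed | //]; last by rewrite andbF.
  rewrite (dvdn_trans ed dv_dn) !andbT; apply: contraNneq neq_dn => def_e.
  by rewrite eqn_dvd dv_dn -def_e.
have : ((f ('X^n - 1))^`()).[x] = 0.
  rewrite prodP defR !fM derivM hornerD !hornerM fP0 mul0r addr0.
  by rewrite fXn hornerD hornerN hornerXn hornerC (prim_expr_order prim_d) subrr mul0r mulr0.
rewrite fXn derivB derivXn derivC subr0 hornerMn hornerXn => /eqP.
by rewrite -mulr_natl mulf_eq0 nat0 (negPf p_n) expf_eq0 (negPf nz_x) andbF.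
Qed.
Local Close Scope ring_scope.

(** * Solvable groups with a prescribed prime graph *)

(** The right regular representation of the semidirect product: the pair (x, y) stands for s ^+ y *
    m ^+ x, and [mf] and [sf] are the right multiplications by m and s. *)
Lemma metacyclic_exists (M N e : nat) :
    0 < M -> 0 < N -> e ^ N = 1 %[mod M] ->
  exists (gT : finGroupType) (m s : gT), [/\ #[m] = M, #[s] = N & m ^ s = m ^+ e].
Proof.
case: M => // M _; case: N => // N _ eN.
pose T := ('I_M.+1 * 'I_N.+1)%type.
have mulK (x : 'I_M.+1) k l : k = l %[mod M.+1] -> (x *+ k = x *+ l)%R.
  by move=> eq_kl; apply/val_inj; rewrite !Zp_mulrn /= -modnMmr eq_kl modnMmr.
pose mf (z : T) : T := (z.1 + inZp 1, z.2)%R.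
pose sf (z : T) : T := (z.1 *+ e, z.2 + inZp 1)%R.
have mf_inj : injective mf.
  move=> [x y] [x' y'] eq; congr (_, _); last exact: (congr1 (fun z : T => z.2) eq).
  exact: addIr (congr1 (fun z : T => z.1) eq).
have sf_inj : injective sf.
  move=> [x y] [x' y'] eq; congr (_, _); last exact: addIr (congr1 (fun z : T => z.2) eq).
  have := congr1 (fun z : T => z.1 *+ (e ^ N))%R eq; rewrite /sf /= -!mulrnA -expnS.
  by rewrite !(mulK _ _ _ eN) !mulr1n.
pose m := perm mf_inj; pose s := perm sf_inj.
have mX k (z : T) : (m ^+ k) z = (z.1 + inZp k, z.2)%R.
  elim: k z => [|k IHk] z.
    by rewrite expg0 perm1; case: z => x y /=; congr (_, _); apply/val_inj; rewrite /= mod0n addn0 modn_small.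
  rewrite expgS permM IHk permE /mf /= -addrA; congr (_ + _, _)%R.
  by apply/val_inj; rewrite /= modnDml modnDmr.
have sX k (z : T) : (s ^+ k) z = (z.1 *+ (e ^ k), z.2 + inZp k)%R.
  elim: k z => [|k IHk] z.
    by rewrite expg0 perm1; case: z => x y /=; congr (_, _); apply/val_inj; rewrite /= mod0n addn0 modn_small.
  rewrite expgS permM IHk permE /sf /= -addrA -mulrnA -expnS; congr (_, _ + _)%R.
  by apply/val_inj; rewrite /= modnDml modnDmr.
exists {perm T}, m, s; split.
- apply/eqP; rewrite eqn_dvd order_dvdn; apply/andP; split.
    apply/eqP/permP=> z; rewrite mX perm1; case: z => x y /=; congr (_, _).
    by apply/val_inj; rewrite /= modnn addn0 modn_small.
  have := congr1 (fun z : T => val z.1) (mX #[m] (0, 0)%R).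
  by rewrite expg_order perm1 /= add0n modn_mod => /esym/eqP.
- apply/eqP; rewrite eqn_dvd order_dvdn; apply/andP; split.
    apply/eqP/permP=> z; rewrite sX perm1; case: z => x y /=; congr (_, _).
      by rewrite (mulK _ _ _ eN) mulr1n.
    by apply/val_inj; rewrite /= modnn addn0 modn_small.
  have := congr1 (fun z : T => val z.2) (sX #[s] (0, 0)%R).
  by rewrite expg_order perm1 /= add0n modn_mod => /esym/eqP.
apply: (mulgI s); rewrite -conjgC; apply/permP=> z; rewrite !permM mX !permE /mf /sf /=.
congr (_, _); rewrite mulrnDl; congr (_ + _)%R.
by apply/val_inj; rewrite Zp_mulrn /= modnMml mul1n.
Qed.

Lemma finField_prim_root (F : finFieldType) (n : nat) :
  0 < n -> n %| #|F|.-1 -> exists z : F, (n.-primitive_root z)%R.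
Proof.
move=> n_gt0 nF; have F_gt0 : 0 < #|F|.-1 by rewrite -subn1 subn_gt0 finNzRing_gt1.
have unity (x : F) : (x != 0 -> x ^+ #|F|.-1 = 1)%R.
  move=> nz_x; apply: (mulfI nz_x); rewrite -exprS prednK ?expf_card ?mulr1 //.
  exact: ltnW (finNzRing_gt1 F).
have /hasP[z _ prim_z]: has (#|F|.-1).-primitive_root%R (enum (predC1 (0 : F)%R)).
  apply: has_prim_root; rewrite ?enum_uniq //.
    by apply/allP=> x; rewrite mem_enum => /unity/unity_rootP.
  by rewrite -cardE cardC1.
by exists (z ^+ (#|F|.-1 %/ n))%R; apply: dvdn_prim_root.
Qed.

(* Induced from J to G, a linear character of J of order n with kernel 'ker chi
   detects exactly the elements of G whose prime order divides n. *)
Definition cyclic_hall_section (gT : finGroupType) (G : {group gT}) (n : nat) : Prop :=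
  exists (J : {group gT}) (rT : finGroupType) (chi : {morphism J >-> rT}),
    [/\ J <| G, cyclic (chi @* J), #|chi @* J| = n,
        coprime #|'ker chi| n & coprime #|G : J| n].

Lemma cyclic_hall_section_pre (gT rT : finGroupType) (G : {group gT})
    (pi : {morphism G >-> rT}) (n : nat) :
  cyclic_hall_section (pi @* G)%G n -> coprime #|'ker pi| n -> cyclic_hall_section G n.
Proof.
case=> J [sT [chi [nsJ cyc oJ coK coJ]]] co_pi.
have sJ : J \subset pi @* G := normal_sub nsJ.
have defG : pi @*^-1 (pi @* G) = G by rewrite morphimGK // subsetIl.
exists (pi @*^-1 J)%G, sT, [morphism of chi \o pi]; split.
- by rewrite -{2}defG morphpre_normal.
- by rewrite morphim_comp morphpreK.
- by rewrite morphim_comp morphpreK.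
- rewrite ker_comp card_morphpre ?coprimeMl ?co_pi //.
  exact: subset_trans (subsetIl _ _) sJ.
by rewrite -{1}defG index_morphpre.
Qed.

(** A generator of the image of [chi] is sent to the root of unity z. The function [lam] is total,
    with exponent 0 as default; it is a character on [J], where the search for the exponent
    succeeds. *)
Lemma discrete_log (gT : finGroupType) (J : {group gT}) (rT : finGroupType)
    (chi : {morphism J >-> rT}) (F : fieldType) (z : F) :
    cyclic (chi @* J) -> (#|chi @* J|.-primitive_root z)%R ->
  exists lam : gT -> F, [/\ {in J &, forall x y, lam (x * y)%g = lam x * lam y}%R,
    lam 1 = 1%R, {in J, forall x, lam x ^+ #|chi @* J| = 1}%R
    & {in J, forall x, lam x = 1%R -> chi x = 1}].
Proof.
case/cyclicP=> g defg; rewrite defg -orderE => prim_z.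
pose dl x := odflt 0 (omap val [pick k : 'I_#[g] | g ^+ k == chi x]).
have dlP x m : chi x = g ^+ m -> (z ^+ dl x = z ^+ m)%R.
  move=> def_x; rewrite /dl; case: pickP => [k /eqP | no_k] /=.
    rewrite def_x => /eqP; rewrite eq_expg_mod_order => /eqP eq_km.
    by rewrite -(prim_expr_mod prim_z) eq_km (prim_expr_mod prim_z).
  have := no_k (Ordinal (ltn_pmod m (order_gt0 g))).
  by rewrite /= def_x expg_mod_order eqxx.
have dlE x : x \in J -> exists2 m, chi x = g ^+ m & (z ^+ dl x = z ^+ m)%R.
  move=> Jx; have: chi x \in chi @* J by rewrite mem_morphim.
  by rewrite defg => /cycleP[m def_x]; exists m => //; apply: dlP.
exists (fun x => z ^+ dl x)%R; split.
- move=> x y Jx Jy; have [k def_x ->] := dlE x Jx; have [l def_y ->] := dlE y Jy.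
  by rewrite -exprD; apply: dlP; rewrite morphM // def_x def_y expgD.
- by rewrite (dlP 1 0) ?morph1.
- move=> x Jx; have [k def_x ->] := dlE x Jx.
  by rewrite exprAC (prim_expr_order prim_z) expr1n.
move=> x Jx; have [k def_x ->] := dlE x Jx => /eqP.
by rewrite -(prim_order_dvd prim_z) order_dvdn -def_x => /eqP.
Qed.

(* The maps twist f h are the elements of the wreath product of 'F_p by gT, acting
   on gT * 'F_p. *)
Definition twist_fun (gT : finGroupType) (p : nat) (f : {ffun gT -> 'F_p}) (h : gT)
    (z : gT * 'F_p) : gT * 'F_p :=
  (z.1 * h, (z.2 + f z.1)%R).

Lemma twist_fun_inj (gT : finGroupType) (p : nat) (f : {ffun gT -> 'F_p}) (h : gT) :
  injective (twist_fun f h).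
Proof.
move=> [g a] [g' a'] eq.
have /mulIg eg : g * h = g' * h by exact: (congr1 (fun z : gT * 'F_p => z.1) eq).
have := congr1 (fun z : gT * 'F_p => z.2) eq.
by rewrite /twist_fun /= eg => /addIr->.
Qed.

Definition twist (gT : finGroupType) (p : nat) (f : {ffun gT -> 'F_p}) (h : gT) :
    {perm (gT * 'F_p)} :=
  perm (@twist_fun_inj gT p f h).

Lemma twistM (gT : finGroupType) (p : nat) (f1 f2 : {ffun gT -> 'F_p}) (h1 h2 : gT) :
  twist f1 h1 * twist f2 h2 = twist [ffun g => f1 g + f2 (g * h1)%g]%R (h1 * h2).
Proof.
by apply/permP=> [[g a]]; rewrite permM !permE /twist_fun /= ffunE mulgA addrA.
Qed.

Lemma twist1 (gT : finGroupType) (p : nat) : twist [ffun => 0%R : 'F_p] (1 : gT) = 1.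
Proof.
by apply/permP=> [[g a]]; rewrite permE perm1 /twist_fun /= ffunE mulg1 addr0.
Qed.

Lemma twist_inj (gT : finGroupType) (p : nat) (f1 f2 : {ffun gT -> 'F_p}) (h1 h2 : gT) :
  twist f1 h1 = twist f2 h2 -> f1 = f2 /\ h1 = h2.
Proof.
move=> eq; have eqz z : twist_fun f1 h1 z = twist_fun f2 h2 z.
  by have := congr1 (fun u : {perm _} => u z) eq; rewrite !permE.
split; last by apply: (mulgI 1); exact: (congr1 (fun z => z.1) (eqz (1, 0%R))).
by apply/ffunP=> g; have := congr1 (fun z => z.2) (eqz (g, 0%R)); rewrite /= !add0r.
Qed.

Lemma twist_eq1 (gT : finGroupType) (p : nat) (f : {ffun gT -> 'F_p}) (h : gT) :
  twist f h = 1 -> f = [ffun => 0%R] /\ h = 1.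
Proof. by move=> eq1; apply: twist_inj; rewrite eq1 twist1. Qed.

Lemma twistX (gT : finGroupType) (p : nat) (f : {ffun gT -> 'F_p}) (m : nat) : twist f 1 ^+ m = twist [ffun g => f g *+ m]%R 1.
Proof.
elim: m => [|m IHm].
  by rewrite expg0 -twist1; congr (twist _ _); apply/ffunP=> g; rewrite !ffunE mulr0n.
rewrite expgS IHm twistM mulg1; congr (twist _ _).
by apply/ffunP=> g; rewrite !ffunE mulg1 mulrS.
Qed.

Lemma twist0X (gT : finGroupType) (p : nat) (h : gT) (m : nat) :
  twist [ffun => 0%R : 'F_p] h ^+ m = twist [ffun => 0%R] (h ^+ m).
Proof.
elim: m => [|m IHm]; first by rewrite !expg0 twist1.
rewrite !expgS IHm twistM; congr (twist _ _).
by apply/ffunP=> g; rewrite !ffunE addr0.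
Qed.

(* The extension of G by the module induced from the linear character lam of J of
   order n with values in 'F_p; an element h of prime order t has a nonzero fixed
   vector in this module unless h lies in J and lam h != 1, that is, unless t
   divides n. *)
Lemma twisted_extension (gT : finGroupType) (G : {group gT}) (n p : nat) :
    prime p -> ~~ (p %| #|G|) -> n %| p.-1 -> cyclic_hall_section G n ->
  exists (rT : finGroupType) (E : {group rT}) (pi : {morphism E >-> gT}),
    [/\ pi @* E = G, p.-group ('ker pi), 'ker pi != 1
      & forall t, prime t -> t %| #|G| -> has_order E (t * p) = ~~ (t %| n)].
Proof.
move=> p_pr p'G n_p [J [sT [chi [nsJG cyc oJ coK coJ]]]].
have [sJG nJG] := andP nsJG.
have n_gt0 : 0 < n by rewrite -oJ cardG_gt0.
have [z prim_z] : exists z : 'F_p, (#|chi @* J|.-primitive_root z)%R.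
  by apply: finField_prim_root; rewrite oJ ?card_Fp.
have [lam [lamM lam1 lamX lamK]] := discrete_log cyc prim_z.
rewrite oJ in lamX.
have charFp m : (m%:R == 0 :> 'F_p)%R = (p %| m) by rewrite (dvdn_pcharf (pchar_Fp p_pr)).
(* The induced module: functions supported on [G] that transform by [lam] under left translation by
   [J]; [G] acts by right translation. *)
pose Vf := [set f : {ffun gT -> 'F_p} | [forall g, (g \notin G) ==> (f g == 0%R)]
    && [forall j in J, forall g, f (j * g)%g == lam j * f g]%R].
have VfP (f : {ffun gT -> 'F_p}) :
    reflect ((forall g, g \notin G -> f g = 0%R) /\
             (forall j g, j \in J -> f (j * g)%g = lam j * f g)%R) (f \in Vf).
  rewrite inE; apply: (iffP andP) => [[/forallP f0 /forall_inP fJ] | [f0 fJ]]; split.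
  - by move=> g nGg; apply/eqP; apply: implyP (f0 g) nGg.
  - by move=> j g Jj; apply/eqP; have /forallP := fJ j Jj; apply.
  - by apply/forallP=> g; apply/implyP=> nGg; rewrite f0.
  by apply/forall_inP=> j Jj; apply/forallP=> g; rewrite fJ.
have Vf0 : [ffun => 0%R] \in Vf.
  by apply/VfP; split=> [g _ | j g _]; rewrite !ffunE ?mulr0.
pose S := [set twist f h | f in Vf, h in G].
have memS f h : f \in Vf -> h \in G -> twist f h \in S.
  by move=> Vff Gh; apply/imset2P; exists f h.
have gS : group_set S.
  apply/group_setP; split; first by rewrite -(twist1 gT p) memS.
  move=> _ _ /imset2P[f1 h1 /VfP[f10 f1J] Gh1 ->] /imset2P[f2 h2 /VfP[f20 f2J] Gh2 ->].
  rewrite twistM memS ?groupM //; apply/VfP; split=> [g nGg | j g Jj]; rewrite !ffunE.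
    by rewrite f10 // f20 ?addr0 // groupMr.
  by rewrite f1J // -mulgA (f2J j) // mulrDr.
pose E := Group gS.
have EP u : u \in E -> exists f h, [/\ f \in Vf, h \in G & u = twist f h].
  by case/imset2P=> f h Vff Gh ->; exists f, h.
pose pif (u : {perm gT * 'F_p}) : gT := (u (1, 0%R)).1.
have pifE f h : pif (twist f h) = h by rewrite /pif permE /twist_fun /= mul1g.
have pifM : {in E &, {morph pif : u v / u * v}}.
  move=> u v /EP[f1 [h1 [Vf1 Gh1 ->]]] /EP[f2 [h2 [Vf2 Gh2 ->]]].
  by rewrite twistM !pifE.
pose pi := Morphism pifM.
have imE : pi @* E = G.
  apply/setP=> h; apply/morphimP/idP=> [[u _ /EP[f [k [_ Gk ->]]] ->] | Gh].
    by rewrite /= pifE.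
  by exists (twist [ffun => 0%R] h); rewrite ?memS //= pifE.
have kerP u : u \in 'ker pi -> exists2 f, f \in Vf & u = twist f 1.
  case/morphpreP=> /EP[f [h [Vff Gh ->]]] /set1P /=; rewrite pifE => ->.
  by exists f.
have twistp (f : {ffun gT -> 'F_p}) : twist f 1 ^+ p = 1.
  rewrite twistX; apply: etrans (twist1 gT p); congr (twist _ _).
  apply/ffunP=> g; rewrite !ffunE.
  by rewrite -mulr_natl (_ : p%:R = 0)%R ?mul0r //; apply/eqP; rewrite charFp.
have pK : p.-group ('ker pi).
  apply/pgroupP=> q q_pr /(Cauchy q_pr)[u /kerP[f Vff ->] oq].
  by rewrite inE /= -(dvdn_prime2 q_pr p_pr) -oq order_dvdn twistp.
(* The function [lam] extended by 0 outside [J], a nonzero vector of the induced module. *)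
pose delta (g : gT) : 'F_p := if g \in J then lam g else 0%R.
have delta0 g : g \notin G -> delta g = 0%R.
  by move=> nGg; rewrite /delta ifN //; apply: contra nGg; apply: subsetP.
have deltaJ j g : j \in J -> (delta (j * g)%g = lam j * delta g)%R.
  move=> Jj; rewrite /delta groupMl //; case: ifP => [Jg | _]; last by rewrite mulr0.
  exact: lamM.
have lamXk x k : x \in J -> (lam (x ^+ k)%g = lam x ^+ k)%R.
  move=> Jx; elim: k => [|k IHk]; first by rewrite expg0 lam1.
  by rewrite expgS lamM ?groupX // IHk exprS.
exists {perm gT * 'F_p}, E, pi; split=> //.
  pose f : {ffun gT -> 'F_p} := [ffun g => delta g].
  have Vff : f \in Vf.
    by apply/VfP; split=> [g nGg | j g Jj]; rewrite !ffunE; [apply: delta0 | apply: deltaJ].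
  apply/trivgPn; exists (twist f 1).
    by apply/morphpreP; split; [apply: memS | rewrite inE /= pifE].
  apply/eqP=> /twist_eq1[/ffunP/(_ 1)].
  by rewrite !ffunE /delta group1 lam1 => /eqP; rewrite oner_eq0.
move=> t t_pr t_G.
have ntp : t != p by apply: contraNneq p'G => <-.
have t_gt0 := prime_gt0 t_pr.
apply/idP/idP=> [/has_orderP[u Eu ou] | t'n].
  pose v := u ^+ t; pose y := u ^+ p.
  have ov : #[v] = p by rewrite orderXdiv ou ?dvdn_mulr // mulKn.
  have oy : #[y] = t by rewrite orderXdiv ou ?dvdn_mull // mulnK ?prime_gt0.
  have Ev : v \in E by apply: groupX.
  have Ey : y \in E by apply: groupX.
  have cvy : commute v y by apply/commute_sym/commuteX2.
  have piv : pi v = 1.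
    apply: contraNeq p'G => nt_piv; have piv_p : pi v ^+ p = 1.
      by rewrite -morphX //; have := expg_order v; rewrite ov => ->; rewrite morph1.
    have Gpv : pi v \in G by rewrite -imE mem_morphim.
    by have := order_dvdG Gpv; rewrite (nt_prime_order p_pr piv_p nt_piv).
  have [f Vff def_v] : exists2 f, f \in Vf & v = twist f 1.
    by apply: kerP; apply/morphpreP; split; rewrite // inE piv.
  have [w [h [Vfw Gh def_y]]] := EP y Ey.
  have f_h g : f (g * h) = f g.
    move: cvy; rewrite /commute def_v def_y !twistM => /twist_inj[/ffunP/(_ g) + _].
    by rewrite !ffunE mulg1 addrC => /addrI.
  have hy : pi y = h by rewrite def_y /= pifE.
  have ht : h ^+ t = 1.
    by rewrite -hy -morphX //; have := expg_order y; rewrite oy => ->; rewrite morph1.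
  have nth : h != 1.
    apply: contraNneq ntp => h1.
    have Ky : y \in 'ker pi by apply/morphpreP; split; rewrite // inE hy h1.
    by have := mem_p_elt pK Ky; rewrite /p_elt oy pnatE.
  have oh : #[h] = t by apply: nt_prime_order.
  apply/negP=> t_n.
  have Jh : h \in J.
    apply: coset_idr; first exact: subsetP nJG h Gh.
    apply/eqP; rewrite -order_eq1 -dvdn1 -(eqP (coprime_dvdr t_n coJ)) dvdn_gcd.
    rewrite -card_quotient // order_dvdG ?mem_quotient // -oh.
    by rewrite morph_order // (subsetP nJG).
  have ntv : v != 1 by rewrite -order_gt1 ov prime_gt1.
  have [f0 fJ] := VfP f Vff.
  have [g0 nz_g0] : exists g, f g != 0%R.
    apply/existsP; apply: contraNT ntv; rewrite negb_exists => /forallP f_0.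
    rewrite def_v; apply/eqP; apply: etrans (twist1 gT p); congr (twist _ _); apply/ffunP=> g.
    by rewrite ffunE; apply/eqP; have := f_0 g; rewrite negbK.
  have Gg0 : g0 \in G by apply: contraR nz_g0 => /f0->.
  (* The value of f at g0 * h is f g0 by invariance, and lam (h ^ g0^-1) * f g0 by equivariance; so
     a conjugate of h lies in 'ker chi, whose order is prime to t. *)
  have Jj : h ^ g0^-1 \in J by rewrite memJ_norm // (subsetP nJG) // groupV.
  have lamj : lam (h ^ g0^-1) = 1%R.
    apply: (mulIf nz_g0); rewrite mul1r -fJ // -[RHS]f_h.
    by rewrite conjgE invgK !mulgA mulgKV.
  have Kj : h ^ g0^-1 \in 'ker chi by apply/morphpreP; split; rewrite // inE lamK.
  have := order_dvdG Kj; rewrite orderJ oh => t_K.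
  have : coprime t t := coprime_dvdl t_K (coprime_dvdr t_n coK).
  by rewrite /coprime gcdnn gtn_eqF ?prime_gt1.
have [h Gh oh] := Cauchy t_pr t_G.
have ht : h ^+ t = 1 by rewrite -oh expg_order.
(* Summing the translates of [delta] over <[h]> gives an invariant vector. Its value at 1 is t,
   which is nonzero modulo p, if h lies in [J]; otherwise only the term i = 0 contributes and the
   value is 1. *)
pose f : {ffun gT -> 'F_p} := [ffun g => \sum_(i < t) delta (g * h ^+ i)%g]%R.
have Vff : f \in Vf.
  apply/VfP; split=> [g nGg | j g Jj]; rewrite !ffunE.
    by apply: big1 => i _; rewrite delta0 // groupMr ?groupX.
  by rewrite big_distrr /=; apply: eq_bigr => i _; rewrite -mulgA; apply: deltaJ.
have f_h g : f (g * h) = f g.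
  pose F i := delta (g * h ^+ i); rewrite !ffunE.
  have -> : (\sum_(i < t) delta (g * h * h ^+ i)%g = \sum_(0 <= i < t) F i.+1)%R.
    by rewrite big_mkord; apply: eq_bigr => i _; rewrite -mulgA -expgS.
  apply: (addrI (F 0)); rewrite -big_nat_recl // big_nat_recr //= big_mkord addrC.
  by rewrite {1}/F ht.
have f1 : f 1 != 0%R.
  rewrite ffunE; have [Jh | nJh] := boolP (h \in J).
    rewrite (eq_bigr (fun _ => 1%R)) => [|i _].
      by rewrite sumr_const card_ord charFp dvdn_prime2 // eq_sym.
    rewrite mul1g /delta groupX // lamXk // (_ : lam h = 1%R) ?expr1n //.
    have lt1 : (lam h ^+ t = 1)%R by rewrite -lamXk // ht lam1.
    (* Both lam h ^+ t and lam h ^+ n are 1, and t and n are coprime. *)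
    have [a _ /dvdnP[b eq_ab]] := Bezoutl n t_gt0.
    have co_tn : gcdn t n = 1%N by apply/eqP; rewrite -[_ == _]/(coprime t n) prime_coprime.
    have : (lam h ^+ (1 + a * n)%N = 1)%R.
      by rewrite -co_tn eq_ab mulnC exprM lt1 expr1n.
    by rewrite exprD expr1 mulnC exprM lamX // expr1n mulr1.
  rewrite (bigD1 (Ordinal t_gt0)) //= big1 => [|i nz_i]; last first.
    rewrite mul1g /delta ifN //; apply: contra nJh => Jhi.
    have /eqP genh : generator <[h]> (h ^+ i).
      rewrite generator_coprime oh prime_coprime // gtnNdvd //.
      by rewrite lt0n; apply: contraNneq nz_i => i0; apply/eqP/val_inj.
    by rewrite -cycle_subG genh cycle_subG.
  by rewrite mul1g expg0 /delta group1 lam1 addr0 oner_eq0.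
clearbody f.
have ov : #[twist f 1] = p.
  apply: nt_prime_order => //; apply: contraNneq f1.
  by move=> /twist_eq1[-> _]; rewrite ffunE.
have oy : #[twist [ffun => 0%R : 'F_p] h] = t.
  apply: nt_prime_order => //; first by rewrite twist0X ht twist1.
  apply/eqP=> /twist_eq1[_ h1].
  by move: t_pr; rewrite -oh h1 order1.
have cvy : commute (twist [ffun => 0%R : 'F_p] h) (twist f 1).
  rewrite /commute !twistM mulg1 mul1g; congr (twist _ _).
  by apply/ffunP=> g; rewrite !ffunE f_h addr0 add0r.
have := @has_order_mul _ E _ _ (memS _ _ Vf0 Gh) (memS _ _ Vff (group1 G)) cvy.
by rewrite oy ov prime_coprimeE //; apply.
Qed.

(** * Metacyclic groups of coprime parameters *)

Definition metacyclic_join (gT : finGroupType) (m s : gT) : {group gT} :=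
  (<[m]> <*> <[s]>)%G.

Lemma conjg_expn (gT : finGroupType) (m s : gT) (e j : nat) :
  m ^ s = m ^+ e -> m ^ (s ^+ j) = m ^+ (e ^ j)%N.
Proof.
move=> ms; elim: j => [|j IHj]; first by rewrite expg0 conjg1.
by rewrite expgSr conjgM IHj conjXg ms -expgM expnS.
Qed.

Lemma metacyclic_joinP (gT : finGroupType) (m s : gT) (e : nat) :
    coprime #[m] #[s] -> m ^ s = m ^+ e ->
  [/\ <[m]> <| metacyclic_join m s, <[m]> * <[s]> = metacyclic_join m s,
      #|metacyclic_join m s| = (#[m] * #[s])%N & solvable (metacyclic_join m s)].
Proof.
move=> co ms; have nms : <[s]> \subset 'N(<[m]>).
  by rewrite cycle_subG inE -cycleJ cycle_subG ms mem_cycle.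
have defK : <[m]> * <[s]> = metacyclic_join m s by rewrite /= norm_joinEr.
have nsmK : <[m]> <| metacyclic_join m s by rewrite /= normalYl.
split=> //; first by rewrite -defK coprime_cardMg.
rewrite (series_sol nsmK) abelian_sol ?cycle_abelian //=.
by rewrite quotientYidl ?quotient_sol ?abelian_sol ?cycle_abelian.
Qed.

(** The v-part of an element of order u v lies in the normal Hall subgroup <[m]>, and its u-part is
    a power of s up to a factor from the abelian group <[m]>. So everything depends on whether the
    elements m' and s' of orders v and u commute. *)
Lemma metacyclic_has_order (gT : finGroupType) (m s : gT) (e u v : nat) :
    coprime #[m] #[s] -> m ^ s = m ^+ e -> prime u -> prime v ->
    u %| #[s] -> v %| #[m] ->
  has_order (metacyclic_join m s) (u * v) = (e ^ (#[s] %/ u) == 1 %[mod v]).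
Proof.
move=> co ms u_pr v_pr u_s v_m; have [nsmK defK oK _] := metacyclic_joinP co ms.
set K := metacyclic_join m s in nsmK defK oK *.
have [M_gt0 u_gt0 v_gt0] := And3 (order_gt0 m) (prime_gt0 u_pr) (prime_gt0 v_pr).
have nuv : u != v.
  apply: contraTneq u_pr => eq_uv; rewrite eq_uv in u_s.
  by rewrite eq_uv; have := coprime_dvdl v_m (coprime_dvdr u_s co);
     rewrite /coprime gcdnn => /eqP->.
set m' := m ^+ (#[m] %/ v); set s' := s ^+ (#[s] %/ u).
have om' : #[m'] = v by rewrite orderXdiv ?dvdn_div // divnA // mulKn.
have os' : #[s'] = u by rewrite orderXdiv ?dvdn_div // divnA // mulKn.
have Km' : m' \in K by rewrite groupX // mem_gen // inE cycle_id.
have Ks' : s' \in K by rewrite groupX // mem_gen // inE cycle_id orbT.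
transitivity (m' ^ s' == m'); last first.
  rewrite conjXg (conjg_expn _ ms) -[X in _ == X]mulg1 /m' -expgM mulnC expgM.
  by rewrite mulg1 -{2}[m ^+ _]expg1 eq_expg_mod_order om'.
have -> : (m' ^ s' == m') = (s' \in 'C[m']).
  rewrite cent1C; apply/eqP/cent1P=> [/conjg_fixP/commgP // |].
  by move/commgP/conjg_fixP.
apply/idP/cent1P=> [/has_orderP[z Kz oz] | cms]; last first.
  have := has_order_mul Ks' Km' cms; rewrite om' os'; apply.
  by rewrite prime_coprimeE.
pose x := z ^+ u; pose y := z ^+ v.
have ox : #[x] = v by rewrite orderXdiv oz ?dvdn_mulr // mulKn.
have oy : #[y] = u by rewrite orderXdiv oz ?dvdn_mull // mulnK.
have hallm : \pi(#[m]).-Hall(K) <[m]>.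
  rewrite pHallE normal_sub //= oK partnM ?order_gt0 // part_pnat_id ?pnat_pi //.
  by rewrite part_p'nat ?muln1 // -coprime_pi'.
have mx : x \in <[m]>.
  by rewrite (mem_normal_Hall hallm) ?groupX // /p_elt ox pnatE // mem_primes v_pr M_gt0.
have : y \in <[m]> * <[s]> by rewrite defK groupX.
case/mulsgP=> _ _ /cycleP[i ->] /cycleP[j ->] def_y.
have [Kmi Ksj] : m ^+ i \in K /\ s ^+ j \in K.
  by rewrite !groupX // mem_gen // inE cycle_id ?orbT.
have ucom : ~~ (u %| #[m]).
  by rewrite -prime_coprime // coprime_sym (coprime_dvdr u_s).
have nt_sj : s ^+ j != 1.
  apply: contraNneq ucom => sj1; rewrite -oy def_y sj1 mulg1.
  exact: order_dvdG (mem_cycle m i).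
have sju : (s ^+ j) ^+ u = 1.
  have nK := subsetP (normal_norm nsmK).
  apply/set1gP; rewrite -(coprime_TIg co).
  apply/setIP; split; last by rewrite !groupX ?cycle_id.
  apply: coset_idr; first by rewrite groupX ?nK.
  rewrite morphX ?nK //= (_ : coset _ (s ^+ j) = coset <[m]> y).
    by rewrite -morphX ?nK ?groupX //= -oy expg_order morph1.
  by rewrite def_y morphM ?nK //= (coset_id (mem_cycle m i)) mul1g.
have osj : #[s ^+ j] = u by apply: nt_prime_order.
have eq_s : <[s ^+ j]> = <[s']>.
  by apply/eqP; rewrite (eq_subG_cyclic (cycle_cyclic s)) ?cycleX -?orderE ?osj ?os'.
have eq_m : <[x]> = <[m']>.
  by apply/eqP; rewrite (eq_subG_cyclic (cycle_cyclic m)) ?cycleX ?cycle_subG -?orderE ?ox ?om'.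
have cxy : commute x y by apply/commute_sym/commuteX2.
have cxm : commute x (m ^+ i).
  by apply: (centsP (cycle_abelian m)); rewrite ?mem_cycle.
have cxs : commute x (s ^+ j).
  rewrite -[s ^+ j](mulKg (m ^+ i)) -def_y.
  by apply: commuteM cxy; apply: commuteV.
have := cents_cycle cxs; rewrite eq_m eq_s => /centsP/(_ _ (cycle_id _) _ (cycle_id _)).
exact: commute_sym.
Qed.

(** Take [J] generated by m and the element s' of order a, and the kernel [D] generated by m ^+ b.
    The congruence says that s' centralizes m modulo [D], so J / D is the product of commuting
    cyclic groups of coprime orders. *)
Lemma metacyclic_hall_section (gT : finGroupType) (m s : gT) (e a b : nat) :
    coprime #[m] #[s] -> m ^ s = m ^+ e ->
    a %| #[s] -> coprime a (#[s] %/ a) -> b %| #[m] -> coprime b (#[m] %/ b) ->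
    e ^ (#[s] %/ a) = 1 %[mod b] ->
  cyclic_hall_section (metacyclic_join m s) (a * b).
Proof.
move=> co ms a_s co_a b_m co_b e1; have [nsmK defK oK _] := metacyclic_joinP co ms.
set K := metacyclic_join m s in nsmK defK oK *.
set M := #[m] in co b_m co_b oK *; set N := #[s] in co a_s co_a e1 oK *.
have a_gt0 : 0 < a := dvdn_gt0 (order_gt0 s) a_s.
have b_gt0 : 0 < b := dvdn_gt0 (order_gt0 m) b_m.
pose s' := s ^+ (N %/ a); pose J := <[m]> <*> <[s']>; pose D := <[m ^+ b]>.
have os' : #[s'] = a by rewrite orderXdiv ?dvdn_div // divnA // mulKn ?order_gt0.
have oD : #|D| = (M %/ b)%N by rewrite -orderE orderXdiv.
have nms : <[s]> \subset 'N(<[m]>).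
  by apply: subset_trans (normal_norm nsmK); rewrite -defK mulG_subr.
have sss' : <[s']> \subset <[s]> by rewrite cycleX.
have nms' := subset_trans sss' nms.
have defJ : <[m]> * <[s']> = J by rewrite /J norm_joinEr.
have co_ms' : coprime #|<[m]>| #|<[s']>| by rewrite -!orderE os' (coprime_dvdr a_s).
have oJ : #|J| = (M * a)%N by rewrite -defJ coprime_cardMg // -!orderE os'.
have sJK : J \subset K by rewrite -defJ -defK mulgS.
have nsJK : J <| K.
  apply: sub_der1_normal sJK; apply: subset_trans (joing_subl _ _).
  apply: der1_min (normal_norm nsmK) _.
  by rewrite quotientYidl ?quotient_abelian ?cycle_abelian.
have nsDK : D <| K.
  apply: char_normal_trans nsmK.
  by rewrite (sub_cyclic_char _ (cycle_cyclic m)) cycleX.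
have sDJ : D \subset J by rewrite -defJ; apply: subset_trans (cycleX _ _) (mulG_subl _ _).
have nDJ : J \subset 'N(D) := subset_trans sJK (normal_norm nsDK).
have nDm : m \in 'N(D) by apply: subsetP nDJ _ _; rewrite mem_gen // inE cycle_id.
have nDs : s' \in 'N(D) by apply: subsetP nDJ _ _; rewrite mem_gen // inE cycle_id orbT.
have oJD : #|J / D| = (a * b)%N.
  rewrite card_quotient // -divgS // oJ oD -{1}(divnK b_m) -mulnA.
  by rewrite mulKn 1?mulnC // divn_gt0 // dvdn_leq ?order_gt0.
exists (<[m]> <*> <[s']>)%G, (coset_of D), (restrm_morphism nDJ (coset_morphism D)).
rewrite /= morphim_restrm ker_restrm ker_coset setIid (setIidPr sDJ) -/J oJD -/D oD.
have co_bN : coprime b N := coprime_dvdl b_m co.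
have co_MN : coprime (M %/ b) N := coprime_dvdl (dvdn_div b_m) co.
split=> //; last first.
- rewrite -divgS // oK oJ divnMl ?order_gt0 // coprimeMr coprime_sym co_a.
  by rewrite coprime_sym (coprime_dvdr (dvdn_div a_s)).
- by rewrite coprimeMr (coprime_dvdr a_s) // coprime_sym.
have mD_b : #[coset D m] %| b by rewrite order_dvdn -morphX //= coset_id ?cycle_id.
rewrite -[cyclic _]/(cyclic (J / D)).
have -> : J / D = <[coset D m]> * <[coset D s']>.
  by rewrite -defJ quotientMl ?cycle_subG // !quotient_cycle.
apply: cyclicM; rewrite ?cycle_cyclic //; last first.
  rewrite -!orderE (coprime_dvdl mD_b) // (coprime_dvdr (morph_order _ nDs)) // os'.
  exact: coprime_dvdl b_m (coprime_dvdr a_s co).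
apply/cents_cycle/commute_sym/commgP/conjg_fixP.
rewrite -morphJ // (conjg_expn _ ms) morphX //= -[RHS]expg1; apply/eqP.
rewrite eq_expg_mod_order; apply/eqP.
by rewrite -(modn_dvdm _ mD_b) e1 modn_dvdm.
Qed.

(** * Prime labels and their products *)

Lemma prime_chain :
  exists q : nat -> nat, (forall i, prime (q i)) /\
    (forall i j, i < j -> q i < q j /\ q i %| (q j).-1).
Proof.
have ex n : exists p, (0 < n) ==> [&& prime p, n < p & n %| p.-1].
  case: n => [|n]; first by exists 0%N.
  by have [p [p_pr lt_np dv_p]] := @prime_1_mod n.+1 n.+1 isT; exists p; rewrite p_pr lt_np.
pose next n := xchoose (ex n).
(* [P j] is the product of the primes chosen before the j-th one, which is congruent to 1 modulo
   this product. *)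
pose P j := iter j (fun n => n * next n)%N 1%N.
have nextP n : 0 < n -> [/\ prime (next n), n < next n & n %| (next n).-1].
  by move=> n_gt0; have /implyP/(_ n_gt0)/and3P[] := xchooseP (ex n).
have P_gt0 j : 0 < P j.
  elim: j => //= j Pj_gt0; have [p_pr _ _] := nextP _ Pj_gt0.
  by rewrite muln_gt0 Pj_gt0 prime_gt0.
exists (fun j => next (P j)); split=> [j | i j lt_ij]; first by have [] := nextP _ (P_gt0 j).
have [_ lt_j dv_j] := nextP _ (P_gt0 j).
have dv_ij : next (P i) %| P j.
  elim: {lt_j dv_j} j lt_ij => // j IHj; rewrite ltnS leq_eqVlt => /orP[/eqP-> | lt_ij].
    exact: dvdn_mull.
  by apply: dvdn_mulr; apply: IHj.
split; last exact: dvdn_trans dv_j.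
by apply: leq_ltn_trans lt_j; apply: dvdn_leq.
Qed.

Lemma chinese_seq (I : eqType) (s : seq I) (m r : I -> nat) :
    uniq s -> {in s &, forall i j, i != j -> coprime (m i) (m j)} ->
  exists e, {in s, forall i, e = r i %[mod m i]}.
Proof.
elim: s => [|i s IHs] /=; first by exists 0%N.
case/andP=> s'i uniq_s co_m.
have [|e eP] := IHs uniq_s; first by move=> j k sj sk; apply: co_m; rewrite inE ?sj ?sk orbT.
have co_i : coprime (m i) (\prod_(j <- s) m j).
  rewrite big_seq; elim/big_rec: _ => [|j k sj]; first exact: coprimen1.
  rewrite coprimeMr => ->; rewrite andbT; apply: co_m; rewrite ?inE ?eqxx ?sj ?orbT //.
  by apply: contraNneq s'i => ->.
exists (chinese (m i) (\prod_(j <- s) m j) (r i) e) => j; rewrite inE => /predU1P[-> | sj].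
  exact: chinese_modl.
have dv_j : m j %| \prod_(k <- s) m k by rewrite (big_rem j) //= dvdn_mulr.
by rewrite -(modn_dvdm _ dv_j) chinese_modr // modn_dvdm // eP.
Qed.

Lemma mod_prime_root (p n : nat) :
  prime p -> 0 < n -> n %| p.-1 -> exists r, forall k, (r ^ k == 1 %[mod p]) = (n %| k).
Proof.
move=> p_pr n_gt0 n_p; have [|z prim_z] := @finField_prim_root 'F_p n n_gt0.
  by rewrite card_Fp.
exists (val z) => k; rewrite (prim_order_dvd prim_z).
have -> : (z ^+ k = ((val z) ^ k)%:R :> 'F_p)%R by rewrite natrX natr_Zp.
by rewrite -[X in _ = (_ == X)]/(1%:R)%R -[RHS](inj_eq (@ord_inj _)) !val_Fp_nat.
Qed.

Definition prime_prod (X : finType) (pr : X -> nat) (A : {set X}) : nat := \prod_(x in A) pr x.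

Lemma prime_prod_gt0 (X : finType) (pr : X -> nat) (A : {set X}) :
  (forall x, prime (pr x)) -> 0 < prime_prod pr A.
Proof. by move=> pr_pr; apply: prodn_gt0 => x; apply: prime_gt0. Qed.

Lemma prime_dvd_prod (X : finType) (pr : X -> nat) (A : {set X}) (t : nat) :
  (forall x, prime (pr x)) -> prime t ->
  reflect (exists2 x, x \in A & t = pr x) (t %| prime_prod pr A).
Proof.
move=> pr_pr t_pr; rewrite /prime_prod; apply: (iffP idP) => [| [x Ax ->]]; last first.
  by rewrite (bigD1 x) //= dvdn_mulr.
rewrite Euclid_dvd_prod // big_has_cond => /hasP[x _ /andP[Ax]].
by rewrite dvdn_prime2 // => /eqP; exists x.
Qed.

Lemma mem_prime_prod (X : finType) (pr : X -> nat) (A : {set X}) (x : X) :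
  (forall x, prime (pr x)) -> injective pr -> (pr x %| prime_prod pr A) = (x \in A).
Proof.
move=> pr_pr inj_pr; apply/(prime_dvd_prod _ pr_pr (pr_pr x))/idP=> [[z Az /inj_pr->] // | Ax].
by exists x.
Qed.

Lemma prime_prod_dvd (X : finType) (pr : X -> nat) (A : {set X}) (k : nat) :
    (forall x, prime (pr x)) -> injective pr ->
  (prime_prod pr A %| k) = [forall x in A, pr x %| k].
Proof.
move=> pr_pr inj_pr; apply/idP/forall_inP=> [dvk x Ax | dvk].
  by apply: dvdn_trans dvk; rewrite mem_prime_prod.
rewrite /prime_prod -big_enum.
have: {in enum A, forall x, pr x %| k} by move=> x; rewrite mem_enum; apply: dvk.
elim: (enum A) (enum_uniq A) => [|x s IHs] /= uniq_s dvs; first by rewrite big_nil dvd1n.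
case/andP: uniq_s => s'x uniq_s; rewrite big_cons Gauss_dvd.
  by rewrite dvs ?mem_head // IHs // => z sz; rewrite dvs // inE sz orbT.
rewrite big_seq; elim/big_rec: _ => [|z m sz]; first exact: coprimen1.
rewrite coprimeMr => ->; rewrite andbT prime_coprimeE // (inj_eq inj_pr).
by apply: contraNneq s'x => ->.
Qed.

Lemma prime_prod_mod (X : finType) (pr : X -> nat) (A : {set X}) (a b : nat) :
    (forall x, prime (pr x)) -> injective pr -> {in A, forall x, a = b %[mod pr x]} ->
  a = b %[mod prime_prod pr A].
Proof.
move=> pr_pr inj_pr; wlog le_ba: a b / b <= a.
  by case/orP: (leq_total b a) => le_ab IH eq_ab; [|apply/esym]; apply: IH => // x /eq_ab.
move=> eq_ab; apply/eqP; rewrite eqn_mod_dvd // prime_prod_dvd //.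
by apply/forall_inP=> x Ax; rewrite -eqn_mod_dvd // eq_ab.
Qed.

Lemma prime_prod_sub (X : finType) (pr : X -> nat) (A B : {set X}) :
  A \subset B -> prime_prod pr B = (prime_prod pr A * prime_prod pr (B :\: A))%N.
Proof. by move=> sAB; rewrite /prime_prod (big_setID A) (setIidPr sAB). Qed.

Lemma coprime_prime_prod (X : finType) (pr : X -> nat) (A B : {set X}) :
    (forall x, prime (pr x)) -> injective pr -> [disjoint A & B] ->
  coprime (prime_prod pr A) (prime_prod pr B).
Proof.
move=> pr_pr inj_pr dAB; rewrite [X in coprime _ X]/prime_prod.
elim/big_rec: _ => [|x k Bx]; first exact: coprimen1.
rewrite coprimeMr => ->; rewrite andbT coprime_sym prime_coprime // mem_prime_prod //.
by rewrite (disjointFl dAB).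
Qed.

(** The generator s, whose order N is the product of the primes of color 0, acts on the v-part of
    <[m]> by an exponent e whose order modulo pr v is the product of the primes of the neighbors of
    v. So the elements of order pr u in <[s]> act trivially there exactly when this product divides
    N %/ pr u, that is, when u is not a neighbor of v. *)
Lemma two_colored_group (X : finType) (y : rel X) (c pr : X -> nat) :
    symmetric y -> (forall u v, y u v -> c u != c v) ->
    (forall u v w, ~~ [&& y u v, y v w & y u w]) ->
    (forall x, prime (pr x)) -> injective pr ->
    (forall u v, c u < c v -> pr u %| (pr v).-1) ->
  exists (gT : finGroupType) (K : {group gT}),
    [/\ solvable K, #|K| = prime_prod pr [set x | c x < 2],
        forall u v, c u < 2 -> c v < 2 -> u != v -> has_order K (pr u * pr v) = ~~ y u v
      & forall w, c w = 2 -> cyclic_hall_section K (prime_prod pr [set x | (c x < 2) && y x w])].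
Proof.
move=> y_sym y_c y_tri pr_pr inj_pr pr_dvd.
pose A := [set x | c x == 0%N]; pose B := [set x | c x == 1%N].
have dAB : [disjoint A & B].
  by apply/pred0P=> x; rewrite !inE; case: eqP => //= ->.
pose nb (v : X) := [set u in A | y u v].
have sub_nb v : nb v \subset A by apply/subsetP=> u; rewrite inE => /andP[].
have gt0 := prime_prod_gt0 _ pr_pr; have dvdP := prime_prod_dvd _ _ pr_pr inj_pr.
have rE v : exists r, c v = 1%N ->
    forall k, (r ^ k == 1 %[mod pr v]) = (prime_prod pr (nb v) %| k).
  have [cv1 | ncv1] := eqVneq (c v) 1%N; last by exists 0%N => cv1; rewrite cv1 in ncv1.
  have [|r rP] := @mod_prime_root (pr v) (prime_prod pr (nb v)) (pr_pr v) (gt0 _).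
    rewrite dvdP; apply/forall_inP=> u /(subsetP (sub_nb v)); rewrite inE => /eqP cu0.
    by apply: pr_dvd; rewrite cu0 cv1.
  by exists r.
have [r rP] : exists r : X -> nat, forall v, c v = 1%N ->
    forall k, (r v ^ k == 1 %[mod pr v]) = (prime_prod pr (nb v) %| k).
  exact: fin_all_exists rE.
have [e eP] : exists e, {in enum B, forall v, e = r v %[mod pr v]}.
  apply: chinese_seq (enum_uniq _) _ => u v _ _ nuv.
  by rewrite prime_coprimeE // (inj_eq inj_pr).
have ordE v k : c v = 1%N -> (e ^ k == 1 %[mod pr v]) = (prime_prod pr (nb v) %| k).
  move=> cv1; rewrite -rP // -modnXm eP ?modnXm //.
  by rewrite mem_enum inE cv1.
pose N := prime_prod pr A; pose M := prime_prod pr B.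
have eq1_mod (C : {set X}) k : C \subset B -> {in C, forall v, prime_prod pr (nb v) %| k} ->
    e ^ k = 1 %[mod prime_prod pr C].
  move=> sCB dvk; apply: prime_prod_mod => // v Cv; apply/eqP.
  by rewrite ordE ?dvk //; move: (subsetP sCB v Cv); rewrite inE => /eqP.
have [|gT [m [s [om os ms]]]] := @metacyclic_exists M N e (gt0 _) (gt0 _).
  apply: eq1_mod => // v Bv; rewrite dvdP; apply/forall_inP=> u nbu.
  by rewrite mem_prime_prod // (subsetP (sub_nb v)).
have co : coprime #[m] #[s] by rewrite om os coprime_sym coprime_prime_prod.
have [_ _ oK solK] := metacyclic_joinP co ms.
have defAB : [set x | c x < 2] = A :|: B.
  by apply/setP=> x; rewrite !inE ltnS; case: (c x) => [|[]].
have c2P x : c x < 2 -> x \in A \/ x \in B.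
  by move=> ltcx; apply/setUP; rewrite -defAB inE.
have dvA x : x \in A -> pr x %| #[s] by rewrite os mem_prime_prod.
have dvB x : x \in B -> pr x %| #[m] by rewrite om mem_prime_prod.
exists gT, (metacyclic_join m s); split=> //.
- rewrite oK om os defAB (@prime_prod_sub _ _ B) ?subsetUr //; congr (_ * prime_prod _ _)%N.
  by rewrite setDUl setDv setU0; apply/esym/setDidPl.
- have sK : <[s]> \subset metacyclic_join m s by apply: joing_subr.
  have mK : <[m]> \subset metacyclic_join m s by apply: joing_subl.
  have AB u v : u \in A -> v \in B -> has_order (metacyclic_join m s) (pr u * pr v) = ~~ y u v.
    move=> Au Bv; rewrite (metacyclic_has_order co ms) ?dvA ?dvB // ordE; last first.
      by move: Bv; rewrite inE => /eqP.
    have N_u : (N %/ pr u = prime_prod pr (A :\ u))%N.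
      rewrite /N (@prime_prod_sub _ _ [set u]) ?sub1set // {1}/prime_prod big_set1.
      by rewrite mulKn ?prime_gt0.
    rewrite os N_u dvdP; apply/forall_inP/idP=> [nb_u | nyuv z].
      apply/negP=> yuv; have := nb_u u; rewrite mem_prime_prod // !inE eqxx /= => H.
      by have := H _; move: Au; rewrite inE yuv => -> /(_ isT).
    rewrite mem_prime_prod // !inE => /andP[-> yzv]; rewrite andbT.
    by apply: contraNneq nyuv => <-.
  move=> u v /c2P[Au | Bu] /c2P[Av | Bv] nuv; last 1 first.
  + rewrite (contra (@y_c u v)); last by move: Bu Bv; rewrite !inE => /eqP-> /eqP->.
    apply: has_orderS mK _; apply: has_order_abelian (cycle_abelian _) _ _ _ _ _; rewrite ?inj_eq //.
      by rewrite -orderE dvB.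
    by rewrite -orderE dvB.
  + rewrite (contra (@y_c u v)); last by move: Au Av; rewrite !inE => /eqP-> /eqP->.
    apply: has_orderS sK _; apply: has_order_abelian (cycle_abelian _) _ _ _ _ _; rewrite ?inj_eq //.
      by rewrite -orderE dvA.
    by rewrite -orderE dvA.
  + exact: AB.
  by rewrite mulnC y_sym; apply: AB.
move=> w cw2; pose C := [set v in B | y v w].
have sCB : C \subset B by apply/subsetP=> v; rewrite inE => /andP[].
have -> : [set x | (c x < 2) && y x w] = nb w :|: C.
  apply/setP=> x; rewrite !inE ltnS; case: (c x) => [|[|k]] //=; rewrite ?orbF ?orFb //.
rewrite (@prime_prod_sub _ _ (nb w)) ?subsetUl //.
have -> : (nb w :|: C) :\: nb w = C.
  rewrite setDUl setDv set0U; apply/setDidPl; rewrite disjoint_sym.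
  exact: disjointWl (sub_nb w) (disjointWr sCB dAB).
have divE (D E : {set X}) : D \subset E ->
    (prime_prod pr E %/ prime_prod pr D = prime_prod pr (E :\: D))%N.
  by move=> sDE; rewrite (prime_prod_sub _ sDE) mulKn.
have coD (D E : {set X}) : coprime (prime_prod pr D) (prime_prod pr (E :\: D)).
  by apply: coprime_prime_prod => //; rewrite disjoint_sym disjoints_subset subsetDr.
have dvD (D E : {set X}) : D \subset E -> prime_prod pr D %| prime_prod pr E.
  by move=> sDE; rewrite (prime_prod_sub _ sDE) dvdn_mulr.
apply: (metacyclic_hall_section co ms); rewrite ?om ?os ?dvD ?divE ?coD //.
(* For v among the neighbors of w of color 1, no neighbor of v of color 0 is also a neighbor of w,
   by triangle-freeness. *)
apply: eq1_mod => // v; rewrite inE => /andP[Bv yvw]; apply: dvD; apply/subsetP=> u.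
rewrite !inE => /andP[-> yuv]; rewrite andbT /=; apply: contraL (y_tri u v w).
by rewrite yuv yvw => ->.
Qed.

(** If x has order prime to p, a power of x in the kernel has both p-power and p'-order, so x and
    its image have the same order. *)
Lemma has_order_p'morphim (gT rT : finGroupType) (E : {group gT}) (pi : {morphism E >-> rT})
    (p k : nat) :
  p.-group ('ker pi) -> coprime p k -> has_order E k = has_order (pi @* E) k.
Proof.
move=> pK co_pk; apply/idP/idP=> [/has_orderP[x Ex ox] | /has_order_morphim //].
apply/has_orderP; exists (pi x); first exact: mem_morphim.
rewrite -{}ox in co_pk *; apply/eqP; rewrite eqn_dvd morph_order // order_dvdn.
set n := #[pi x]; have Kxn : x ^+ n \in 'ker pi.
  by apply/kerP; rewrite ?groupX // morphX // expg_order.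
rewrite -order_eq1 -dvdn1 -(eqnP (_ : coprime #[x ^+ n] #[x])) ?dvdn_gcd ?dvdnn ?orderXdvd //.
have [m ->] := p_natP (mem_p_elt pK Kxn).
exact: coprimeXl.
Qed.

(** The order of [G] is described through its prime divisors only, since each added vertex
    contributes an unspecified power of its prime. The section is kept for all w of color 2 so that
    the next vertex can be added: it is pulled back along [pi], whose kernel has order prime to the
    primes involved. *)
Lemma three_colored_group (X : finType) (y : rel X) (c pr : X -> nat) (s : seq X) :
    symmetric y -> (forall u v, y u v -> c u != c v) ->
    (forall u v w, ~~ [&& y u v, y v w & y u w]) ->
    (forall x, prime (pr x)) -> injective pr ->
    (forall u v, c u < c v -> pr u %| (pr v).-1) ->
    uniq s -> {in s, forall w, c w = 2} ->
  exists (gT : finGroupType) (G : {group gT}),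
    [/\ solvable G,
        forall t, prime t ->
          (t %| #|G|) = (t %| prime_prod pr [set x | (c x < 2) || (x \in s)]),
        {in [set x | (c x < 2) || (x \in s)] &, forall u v, u != v ->
          has_order G (pr u * pr v) = ~~ y u v}
      & forall w, c w = 2 -> cyclic_hall_section G (prime_prod pr [set x | (c x < 2) && y x w])].
Proof.
move=> y_sym y_c y_tri pr_pr inj_pr pr_dvd; elim: s => [_ _ | w s IHs] /=.
  have [gT [K [solK oK adjK secK]]] := two_colored_group y_sym y_c y_tri pr_pr inj_pr pr_dvd.
  have defD : [set x | (c x < 2) || (x \in [::])] = [set x | c x < 2].
    by apply/setP=> x; rewrite !inE orbF.
  exists gT, K; rewrite defD oK; split=> // u v; rewrite !inE => cu cv; exact: adjK.
case/andP=> s'w uniq_s sw; have cw2 : c w = 2 by apply: sw; rewrite mem_head.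
have [|gT [G [solG primesG adjG secG]]] := IHs uniq_s.
  by move=> x sx; apply: sw; rewrite inE sx orbT.
set D := [set x | _] in primesG adjG.
set n := fun w => prime_prod pr [set x | (c x < 2) && y x w].
have D'w : w \notin D by rewrite inE cw2.
have defD : [set x | (c x < 2) || (x \in w :: s)] = w |: D.
  by apply/setP=> x; rewrite !inE orbCA.
have [||rT [E [pi [imE pK ntK adjE]]]] :=
    twisted_extension (pr_pr w) _ _ (secG w cw2).
- by rewrite primesG // mem_prime_prod.
- rewrite prime_prod_dvd //; apply/forall_inP=> x; rewrite inE => /andP[cx _].
  by apply: pr_dvd; rewrite cw2.
have oE : (#|'ker pi| * #|G|)%N = #|E|.
  by rewrite -imE card_morphim setIid Lagrange // subsetIl.
have [_ _ [k oK]] := pgroup_pdiv pK ntK.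
exists rT, E; rewrite defD; split.
- rewrite (series_sol (ker_normal pi)) (pgroup_sol pK) /=.
  by rewrite (isog_sol (first_isog pi)) /= imE.
- move=> t t_pr; rewrite -oE Euclid_dvdM // oK Euclid_dvdX // andbT primesG //.
  by rewrite {2}/prime_prod big_setU1 // Euclid_dvdM.
- have adjW x : x \in D -> has_order E (pr x * pr w) = ~~ y x w.
    move=> Dx; rewrite adjE ?pr_pr //; last by rewrite primesG // mem_prime_prod.
    rewrite mem_prime_prod // inE; case: ltnP => //= ge2_cx.
    apply/esym; apply: contraTN Dx => /y_c.
    by rewrite inE ltnNge ge2_cx /= cw2; apply: contra => sx; rewrite sw // inE sx orbT.
  move=> u v /setU1P[-> | Du] /setU1P[-> | Dv] nuv.
  + by rewrite eqxx in nuv.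
  + by rewrite mulnC y_sym adjW.
  + exact: adjW.
  rewrite (has_order_p'morphim pK) ?imE ?adjG // coprimeMr !prime_coprimeE // !(inj_eq inj_pr).
  by rewrite !(contraNneq _ D'w) // => ->.
move=> v cv2; apply: (@cyclic_hall_section_pre _ _ _ pi).
  by rewrite (_ : (pi @* E)%G = G); [apply: secG | apply: group_inj].
by rewrite oK coprimeXl // prime_coprime // mem_prime_prod // inE cw2.
Qed.

(** The index c x * #|X| + enum_rank x sorts the vertices by color, so that the chain of primes
    respects the colors and is injective on each of them. *)
Lemma graph_prime_labels (X : finType) (c : X -> nat) :
  exists pr : X -> nat, [/\ forall x, prime (pr x), injective pr
    & forall u v, c u < c v -> pr u %| (pr v).-1].
Proof.
have [q [q_pr qP]] := prime_chain.
have inj_q : injective q.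
  move=> i j eq_q; case: (ltngtP i j) => // /qP[+ _]; by rewrite eq_q ltnn.
pose idx x := (c x * #|X| + enum_rank x)%N.
exists (fun x => q (idx x)); split=> [x | x z /inj_q eq_xz | u v lt_uv].
- exact: q_pr.
- apply: enum_rank_inj; apply: ord_inj; have := congr1 (modn^~ #|X|) eq_xz.
  by rewrite !modnMDl !modn_small.
apply: (proj2 (qP _ _ _)); apply: leq_trans (_ : (c u).+1 * #|X| <= _)%N.
  by rewrite mulSnr ltn_add2l.
by apply: leq_trans (leq_addr _ _); rewrite leq_mul2r lt_uv orbT.
Qed.

Theorem theorem3p10 (X : sgraph) :
  (exists (gT : finGroupType) (G : {group gT}),
      pseudo_U33_solvable G /\ sgraph_iso X (prime_graph G)) <->
  (colorable 3 (complement X) /\ triangle_free (complement X)).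
Proof.
split=> [[gT [G [solG [f bij_f adj_f]]]] | [[c cP] triP]].
  have [[c cP] triG] := pseudo_coloring solG; have inj_f := bij_inj bij_f.
  pose p (x : X) : nat := ssval (f x).
  have pG x : prime (p x) /\ p x %| #|G|.
    by have := ssvalP (f x); rewrite mem_primes => /and3P[].
  have adjE (x y : X) : compl_adj x y -> p x != p y /\ ~~ has_order G (p x * p y).
    have -> : compl_adj x y = (x != y) && ~~ ((f x != f y) && has_order G (p x * p y)).
      by rewrite /compl_adj /= -adj_f.
    rewrite (inj_eq inj_f); case/andP=> nxy; rewrite nxy /= => no_xy.
    by split=> //; apply: contra nxy => /eqP/val_inj/inj_f->.
  split.
    exists (fun x => c (p x)) => x y /adjE[nxy no_xy].
    by have [[px xG] [py yG]] := (pG x, pG y); apply: cP.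
  case=> x [y [z /and3P[/adjE[nxy no_xy] /adjE[nyz no_yz] /adjE[nxz no_xz]]]].
  have [[px xG] [py yG] [pz zG]] := And3 (pG x) (pG y) (pG z).
  have := triG _ _ _ px py pz nxy nyz nxz xG yG zG.
  by rewrite (negPf no_xy) (negPf no_yz) (negPf no_xz).
have [pr [pr_pr inj_pr pr_dvd]] := graph_prime_labels (fun x : X => c x : nat).
pose s := enum [set x : X | c x == 2 :> nat].
have [||||gT [G [solG primesG adjG _]]] := @three_colored_group X (@compl_adj X) (fun x => c x) pr s
  (@compl_adj_sym X) _ _ pr_pr inj_pr pr_dvd.
- exact: cP.
- by move=> u v w; apply/negP=> uvw; apply: triP; exists u, v, w.
- exact: enum_uniq.
- by move=> w; rewrite mem_enum inE => /eqP.
have defD : [set x : X | (c x < 2) || (x \in s)] = [set: X].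
  by apply/setP=> x; rewrite !inE mem_enum inE orbC -leq_eqVlt -ltnS ltn_ord.
rewrite defD in primesG adjG.
have prG x : pr x \in primes #|G|.
  by rewrite mem_primes pr_pr cardG_gt0 primesG // mem_prime_prod ?inE.
pose f x : prime_graph G := SeqSub (prG x).
have surj (t : prime_graph G) : exists x, pr x == ssval t.
  have := ssvalP t; rewrite mem_primes => /and3P[t_pr _].
  by rewrite primesG // => /(prime_dvd_prod _ pr_pr t_pr)[x _ ->]; exists x.
exists gT, G; split; first exact: solvable_pseudo.
exists f.
  exists (fun t => xchoose (surj t)) => [x | t].
    by apply: inj_pr; apply/eqP: (xchooseP (surj (f x))).
  by apply: val_inj; apply/eqP: (xchooseP (surj t)).
move=> x y; have [-> | nxy] := eqVneq x y; first by rewrite !adj_irrefl.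
transitivity ((f x != f y) && has_order G (pr x * pr y)); first by [].
rewrite adjG ?inE // /compl_adj /= nxy negbK andb_idl // => _.
by apply: contra nxy => /eqP[/inj_pr->].
Qed.
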